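(* Let $r,d,D,m$ be positive integers. There exists $N_0=N_0(d,D,m,r)$ such that the following holds. Let $H$ be an $r$-uniform semialgebraic hypergraph of description complexity $(d,D,m)$ on $N\geq N_0$ vertices. Then $H$ contains a clique or an independent set of size $n$, where $n$ is the least positive integer with $N\leq \mathrm{tw}_{3D^3}(n)$.
   Context: The tower function is defined by $\mathrm{tw}_1(x)=x$ and $\mathrm{tw}_k(x)=2^{\mathrm{tw}_{k-1}(x)}$ for $k\geq 2$. For an ordered set $A$ and integer $k\ge 0$, $A^{(k)}=\{(a_1,\dots,a_k)\in A^k: a_1<\dots<a_k\}$. Semialgebraic hypergraph of description complexity $(d,D,m)$: let $V\subset\mathbb{R}^d$ be a finite set with a total ordering, let $f_1,\dots,f_m:(\mathbb{R}^d)^r\to\mathbb{R}$ be polynomials of (total) degree at most $D$, and let $\Gamma:\{\texttt{false},\texttt{true}\}^m\to\{\texttt{false},\texttt{true}\}$ be a Boolean formula. The $r$-uniform hypergraph $H$ on vertex set $V$ in which $x\in V^{(r)}$ is an edge if and only if $\Gamma(f_1(x)\le 0,\dots,f_m(x)\le 0)=\texttt{true}$, and any hypergraph isomorphic to it, is called semialgebraic of description complexity $(d,D,m)$. A clique is a vertex set all of whose $r$-element subsets are edges; an independent set is a vertex set containing no edge. *)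

(* Defs.v *)
From HB Require Import structures.
From mathcomp Require Import all_boot all_order all_algebra.
From mathcomp Require Import reals.
From mathcomp Require Import mpoly.

Set Implicit Arguments.
Unset Strict Implicit.
Unset Printing Implicit Defensive.

Import Order.TTheory GRing.Theory Num.Theory.
Local Open Scope ring_scope.

(** Tower function: tw 1 x = x, tw (k+1) x = 2 ^ (tw k x).
    (tw 0 x := x is an irrelevant convention.) *)
Fixpoint tw (k x : nat) : nat :=
  match k with
  | 0 => x
  | S k' => match k' with 0 => x | _ => 2 ^ tw k' x end
  end.

(** A strictly increasing map 'I_r -> 'I_N, i.e. an element of V^(r) where
    the vertex set V is identified (with its total order) with 'I_N. *)
Definition strictly_incr (r N : nat) (t : 'I_r -> 'I_N) : Prop :=
  forall i j : 'I_r, (i < j)%N -> (t i < t j)%N.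

(** The semialgebraic edge relation.  Vertex [v : 'I_N] is the point
    [pts v] in R^d; the r-tuple (pts (t 0), ..., pts (t (r-1))) in (R^d)^r
    is flattened (row-major, via [mxvec]) to a vector in R^(r*d), at which
    the polynomials [P j] are evaluated. *)
Definition sa_edge (R : realType) (d m r N : nat)
    (P : 'I_m -> {mpoly R[r * d]}) (Gamma : ('I_m -> bool) -> bool)
    (pts : 'I_N -> 'I_d -> R) (t : 'I_r -> 'I_N) : bool :=
  Gamma (fun j =>
    (P j).@[fun k => mxvec (\matrix_(i < r, l < d) pts (t i) l) 0 k] <= 0).

Definition sa_clique (R : realType) (d m r N : nat)
    (P : 'I_m -> {mpoly R[r * d]}) (Gamma : ('I_m -> bool) -> bool)
    (pts : 'I_N -> 'I_d -> R) (S : {set 'I_N}) : Prop :=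
  forall t : 'I_r -> 'I_N, strictly_incr t -> (forall i, t i \in S) ->
    sa_edge P Gamma pts t.

Definition sa_independent (R : realType) (d m r N : nat)
    (P : 'I_m -> {mpoly R[r * d]}) (Gamma : ('I_m -> bool) -> bool)
    (pts : 'I_N -> 'I_d -> R) (S : {set 'I_N}) : Prop :=
  forall t : 'I_r -> 'I_N, strictly_incr t -> (forall i, t i \in S) ->
    ~~ sa_edge P Gamma pts t.

(* Main.v *)
Require Import Defs.
From HB Require Import structures.
From mathcomp Require Import all_boot all_order all_algebra.
From mathcomp Require Import boolp reals.
From mathcomp Require Import mpoly.
From mathcomp Require Import zify ring lra.

(** A polynomial of degree at most [D] in [r] points is a sum, over the sets [I]
of at most [D] indices, of functions [g_I] of the points indexed by [I]; nothing
else about polynomials is used.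

Call a function of [k] points rapid when it has constant sign and moving one
point changes its size by a large factor, in a direction depending only on the
index of the point.  Take an arbitrary function of [k] points.  By Ramsey's
theorem for (2k+1)-tuples we may compare, uniformly, its mixed differences over
neighbouring boxes; since mixed differences are additive, along each coordinate
they either grow or decay geometrically.  Summing the unit mixed differences over
the region lying on the small side in each coordinate gives a function that is
zero or rapid and differs from the original one by functions of [k-1] points.
Doing this for [k = D, ..., 1] makes all [g_I] zero or rapid.

By Ramsey's theorem for (2D)-tuples, the sizes of [g_I] and [g_I'] then compare
in the same way at all tuples; they cannot stay within a bounded factor of each
other, because some point occurs in only one of them.  So one term dominates and
the sign of the sum is constant.  The height of the tower depends only on [D].

For [D = 1] the height 3 leaves room for a single exponential: one step of the
Erdos-Rado argument reduces triples to pairs, and from then on every relation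
involved is transitive or has a transitive complement, so that homogeneous sets
of polynomial size are given by long chains or antichains. *)

Set Implicit Arguments.
Unset Strict Implicit.
Unset Printing Implicit Defensive.

Import Order.TTheory GRing.Theory Num.Theory.

(** * Towers and embeddings *)

Lemma twS h x : tw h.+2 x = 2 ^ tw h.+1 x.
Proof. by []. Qed.

Lemma leq_tw h x y : x <= y -> tw h.+1 x <= tw h.+1 y.
Proof.
move=> le_xy; elim: h => [//|h IHh].
by rewrite !twS leq_exp2l.
Qed.

Lemma tw_geq h x : x <= tw h.+1 x.
Proof.
elim: h => [//|h IHh]; rewrite twS.
exact: leq_trans IHh (ltnW (ltn_expl _ _)).
Qed.

Lemma leq_tw_height h h' x : h <= h' -> tw h.+1 x <= tw h'.+1 x.
Proof.
move=> le_h; rewrite -(subnK le_h); elim: (h' - h) => [//|d IHd].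
apply: leq_trans IHd _; rewrite addSn twS.
exact: ltnW (ltn_expl _ _).
Qed.

Lemma twD a b x : tw a.+1 (tw b.+1 x) = tw (a + b).+1 x.
Proof. by elim: a => [//|a IHa]; rewrite addSn !twS IHa. Qed.

Lemma exp_tw h x c : 2 <= x -> 0 < c -> tw h.+1 x ^ c <= tw h.+1 (x ^ c).
Proof.
move=> x2 c0; elim: h => [//|h IHh]; rewrite !twS -expnM leq_exp2l //.
apply: leq_trans IHh; case: c c0 => // c _.
rewrite mulnC expnSr leq_mul2r; apply/orP; right.
have le2 : 2 <= tw h.+1 x by exact: leq_trans (tw_geq _ _).
by apply: (@leq_trans (2 ^ c)); [exact: ltn_expl | case: c => // c; rewrite leq_exp2r].
Qed.

(** Polynomial losses only change the exponent [c], so that under composition the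
    heights add up (with no extra term). *)
Definition forced (h : nat) (P : nat -> nat -> Prop) : Prop :=
  exists2 c, 0 < c & forall n N, 2 <= n -> tw h.+1 (n ^ c) <= N -> P N n.

Lemma forced_trans a b (P Q S : nat -> nat -> Prop) :
  (forall N M n, 2 <= n -> P N M -> Q M n -> S N n) ->
  forced a P -> forced b Q -> forced (a + b) S.
Proof.
move=> PQS [c1 c1_gt0 fP] [c2 c2_gt0 fQ].
exists (c2 * c1); first by rewrite muln_gt0 c2_gt0.
move=> n N n2 leN.
have n2' : 2 <= n ^ c2 by apply: (leq_trans n2); rewrite -[leqLHS]expn1 leq_pexp2l // (ltnW n2).
apply: (PQS N (tw b.+1 (n ^ c2))) => //; last exact: fQ.
apply: fP; first exact: leq_trans n2' (tw_geq _ _).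
apply: leq_trans leN; rewrite -twD; apply: leq_tw.
by rewrite expnM; apply: exp_tw.
Qed.

Lemma forced_weaken a b (P Q : nat -> nat -> Prop) :
  a <= b -> (forall N n, 2 <= n -> P N n -> Q N n) -> forced a P -> forced b Q.
Proof.
move=> le_ab PQ [c c0 fP]; exists c => // n N n2 leN.
by apply: PQ => //; apply: fP => //; apply: leq_trans leN; apply: leq_tw_height.
Qed.

(** Since [n >= 2], a linear function of [n] is at most a power of [n], so linear losses cost no
    height. *)
Lemma forced_linear a b (P : nat -> nat -> Prop) :
  (forall N n, a * n + b <= N -> P N n) -> forced 0 P.
Proof.
move=> HP; exists (a + b).+1 => // n N n2 leN; apply: HP; apply: leq_trans leN => /=.
have leab : a + b < n ^ (a + b).
  apply: leq_trans (ltn_expl (a + b) (ltnSn 1)) _.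
  by case: (a + b) => // k; rewrite leq_exp2r.
rewrite expnSr; apply: (@leq_trans ((a + b) * n)).
  by rewrite mulnDl leq_add2l leq_pmulr // ltnW.
by rewrite leq_mul2r (ltnW leab) orbT.
Qed.

(** The lower bound moves up with the head, so that inductions can peel off the first point. *)
Fixpoint incr (a n : nat) (x : seq nat) : bool :=
  if x is y :: x' then [&& a <= y, y < n & incr y.+1 n x'] else true.

Lemma incrE a n x : incr a n x = sorted ltn x && all (fun y => a <= y < n) x.
Proof.
elim: x a => [//|y x IHx] a /=; rewrite IHx.
case: (a <= y) / idP => [le_ay|]; last by rewrite /= andbF.
case: (y < n) / idP => [lt_yn|]; last by rewrite /= andbF.
rewrite /= path_sortedE; last exact: ltn_trans.
case: (sorted ltn x); rewrite /= ?andbF // andbT -all_predI.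
by apply: eq_all => z /=; lia.
Qed.

Lemma incr_weaken a a' n n' x : a' <= a -> n <= n' -> incr a n x -> incr a' n' x.
Proof.
rewrite !incrE => le_a le_n /andP[-> /allP Hx] /=; apply/allP => y /Hx; lia.
Qed.

Lemma incr_cat a n u v :
  incr a n (u ++ v) = incr a n u && incr (last a (map S u)) n v.
Proof.
by elim: u a => [//|y u IHu] a /=; rewrite IHu !andbA.
Qed.

Lemma incr_iota a n m : a + m <= n -> incr a n (iota a m).
Proof.
elim: m a => [//|m IHm] a Han /=; rewrite leqnn IHm; lia.
Qed.

(** Maps on all of [nat], constrained only below [n], compose without casts between ordinals. *)
Definition embeds (e : nat -> nat) (n N : nat) : Prop :=
  (forall i j, i < j -> j < n -> e i < e j) /\ (forall i, i < n -> e i < N).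

Lemma embeds_incr e n N x : embeds e n N -> incr 0 n x -> incr 0 N (map e x).
Proof.
case=> e_lt e_N; rewrite !incrE => /andP[Hs /allP Hx].
apply/andP; split; last by apply/allP => _ /mapP[y /Hx yn ->]; apply: e_N; lia.
rewrite sorted_map; apply: (@sub_in_sorted _ (fun y => y < n)) Hs; last first.
  by apply/allP => y /Hx; lia.
by move=> i j _; rewrite !unfold_in /= => jn ij; apply: e_lt.
Qed.

Lemma embeds_trans e1 e2 n M N :
  embeds e1 M N -> embeds e2 n M -> embeds (e1 \o e2) n N.
Proof.
move=> [lt1 N1] [lt2 N2]; split=> [i j ij jn|i iN] /=; last exact/N1/N2.
by apply: lt1; [exact: lt2 | exact: N2].
Qed.

Lemma embeds_nth s N : sorted ltn s -> all (fun y => y < N) s ->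
  embeds (nth 0 s) (size s) N.
Proof.
move=> ss /allP sN; split=> [i j ij js|i si]; last exact/sN/mem_nth.
by apply: (sorted_ltn_nth ltn_trans) => //; rewrite inE // (ltn_trans ij).
Qed.

(** * The Erdos-Rado argument *)

Lemma pigeonhole (F : finType) (v : nat -> F) (A : seq nat) k :
  F -> 0 < k -> #|F| * k <= size A -> exists c, k <= size [seq y <- A | v y == c].
Proof.
move=> c0 k0 leA; apply/existsP; apply: contraLR leA => /existsPn noc.
have -> : size A = \sum_(c : F) size [seq y <- A | v y == c].
  elim: A {noc} => [|a A IHA]; first by rewrite big1.
  rewrite (eq_bigr (fun c => (v a == c) + size [seq y <- A | v y == c])) => [|c _].
    by rewrite big_split /= -IHA (bigD1 (v a)) //= eqxx big1 // => c; rewrite eq_sym => /negbTE->.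
  by rewrite /=; case: (v a == c).
rewrite -ltnNge; apply: (@leq_ltn_trans (\sum_(c : F) k.-1)).
  by apply: leq_sum => c _; have := noc c; lia.
rewrite sum_nat_const ltn_pmul2l; first by lia.
by apply/card_gt0P; exists c0.
Qed.

(** The list [p] holds the points chosen so far and [A] the candidates, which all give the same
    colours as last points after tuples from [p]. The least candidate [a] is chosen, and a large
    class of candidates that still agree after tuples from [rcons p a] is kept. *)
Lemma erdos_rado_seq (T : finType) (chi : seq nat -> T) K n m p A :
  sorted ltn A -> size p + m = n -> (2 * #|T| ^ (n.+1 ^ K)) ^ m <= size A ->
  (forall x y z, size x = K -> {subset x <= p} -> y \in A -> z \in A ->
     chi (rcons x y) = chi (rcons x z)) ->
  exists s, [/\ sorted ltn s, {subset s <= A}, size s = m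
    & forall x y z, size x = K -> sorted ltn (rcons x y) ->
      sorted ltn (rcons x z) -> {subset x <= p ++ s} -> y \in s -> z \in s ->
      chi (rcons x y) = chi (rcons x z)].
Proof.
elim: m p A => [|m IHm] p A sA sz_p leA Hp; first by exists [::].
case: A sA leA Hp => [|a A] sA leA Hp.
  move: leA; rewrite leqn0 expn_eq0 muln_eq0 /= expn_eq0.
  have : 0 < #|T| by apply/card_gt0P; exists (chi [::]).
  by case: #|T|.
(* [W] is twice the number of colour vectors; the factor 2 pays for the removal of [a] from the
   candidates. *)
set W := 2 * _ in leA IHm.
have T0 : 0 < #|T| by apply/card_gt0P; exists (chi [::]).
have W0 : 0 < W ^ m by rewrite expn_gt0 /W muln_gt0 expn_gt0 T0.
pose p' := rcons p a.
(* The colour vector of [y]: the colours of [y] after all tuples of chosen points, given by their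
   indices in [p']. Indices past the end read the default 0, which can only refine the classes. *)
pose v y := [ffun u : K.-tuple 'I_n.+1 =>
  chi (rcons [seq nth 0 p' (i : 'I_n.+1) | i <- u] y)].
have [|c lec] := @pigeonhole {ffun K.-tuple 'I_n.+1 -> T} v A (W ^ m) (v 0) W0.
  rewrite card_ffun card_tuple card_ord.
  move: leA; rewrite /= expnS {1}/W -mulnA mul2n -addnn.
  have : 0 < #|T| ^ n.+1 ^ K * W ^ m by rewrite muln_gt0 expn_gt0 T0.
  by move: (_ * _) => Z; lia.
have A'A y : y \in [seq y <- A | v y == c] -> y \in A by rewrite mem_filter => /andP[].
have aA y : y \in A -> a < y.
  by move=> yA; have /allP := order_path_min ltn_trans sA; apply.
have [||||s [ss sA' szs Hs]] := IHm p' [seq y <- A | v y == c].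
- by apply: sorted_filter; [exact: ltn_trans | exact: path_sorted sA].
- by rewrite size_rcons; lia.
- exact: lec.
- move=> x y z szx xp yA zA.
  have := yA; rewrite mem_filter => /andP[/eqP vy _].
  have := zA; rewrite mem_filter => /andP[/eqP vz _].
  have szu : size [seq inord (index t p') : 'I_n.+1 | t <- x] == K by rewrite size_map szx.
  have := congr1 (fun f : {ffun _} => f (Tuple szu)) (etrans vy (esym vz)).
  rewrite !ffunE /= -map_comp.
  have -> // : [seq ((fun i : 'I_n.+1 => nth 0 p' i) \o (fun t => inord (index t p'))) i | i <- x] = x.
  rewrite -[RHS]map_id; apply/eq_in_map => t tx /=.
  rewrite inordK ?nth_index ?xp //.
  by have := xp t tx; rewrite -index_mem size_rcons; lia.
exists (a :: s); split=> [||/=|]; rewrite ?szs //.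
- by rewrite /= path_sortedE; [rewrite ss andbT; apply/allP => y /sA'/A'A/aA | exact: ltn_trans].
- by move=> y; rewrite !inE => /orP[->//|/sA'/A'A->]; rewrite orbT.
(* [a] is the least new point, so a tuple ending at [a] takes its other points from [p], where the
   old invariant applies. *)
have sub_p x w : sorted ltn (rcons x w) -> {subset x <= p ++ a :: s} -> w = a -> {subset x <= p}.
  move=> sw xs wa t tx; have := xs t tx; rewrite mem_cat inE => /or3P[//|/eqP ta|ts].
    move: sw; rewrite -cats1 (sorted_pairwise ltn_trans) pairwise_cat wa.
    by case/andP=> /allrelP /(_ t a tx); rewrite mem_head ta ltnn => /(_ isT).
  move: sw; rewrite -cats1 (sorted_pairwise ltn_trans) pairwise_cat wa.
  case/andP=> /allrelP /(_ t a tx); rewrite mem_head => /(_ isT) ta.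
  by have := aA _ (A'A _ (sA' _ ts)); lia.
have in_A w : w \in a :: s -> w \in a :: A.
  by rewrite !inE => /orP[->//|/sA'/A'A->]; rewrite orbT.
move=> x y z szx sy sz xs ys zs.
have [ya|ya] := eqVneq y a; first by apply: Hp => //; [exact: sub_p ya | exact: in_A | exact: in_A].
have [za|za] := eqVneq z a; first by apply: Hp => //; [exact: sub_p za | exact: in_A | exact: in_A].
apply: Hs => //.
- by rewrite /p' cat_rcons.
- by move: ys; rewrite inE (negbTE ya).
- by move: zs; rewrite inE (negbTE za).
Qed.

(** One exponential removes the dependence on the last point. All heights below are counts of uses
    of this step. *)
Lemma erdos_rado (T : finType) K :
  forced 1 (fun N n => forall chi : seq nat -> T, exists e chi', embeds e n N /\
    forall x y, size x = K.+1 -> incr 0 n (rcons x y) ->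
      chi (map e (rcons x y)) = chi' x).
Proof.
(* The exponent collects three factors: [n], [1 + #|T| <= n ^ (1 + #|T|)] and
   [n.+1 ^ K.+1 <= n ^ (2 * K.+1)]. *)
exists (2 + #|T| + 2 * K.+1) => // n N n2 leN chi.
have T0 : 0 < #|T| by apply/card_gt0P; exists (chi [::]).
have [||||s [ss sN szs Hs]] := @erdos_rado_seq T chi K.+1 n n [::] (iota 0 N).
- exact: iota_ltn_sorted.
- by [].
- rewrite size_iota; apply: leq_trans leN; rewrite twS /=.
  apply: (@leq_trans ((2 ^ (1 + #|T| * n.+1 ^ K.+1)) ^ n)).
    case: n n2 => [//|n] n2.
    rewrite leq_exp2r // expnD leq_mul2l /=.
    rewrite expnM; have : 0 < n.+2 ^ K.+1 by rewrite expn_gt0.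
    move: (n.+2 ^ K.+1) => k k0; rewrite leq_exp2r //.
    exact: ltnW (ltn_expl _ _).
  rewrite -expnM leq_exp2l //.
  have le_n : n.+1 ^ K.+1 <= n ^ (2 * K.+1).
    rewrite expnM leq_exp2r //.
    by rewrite expnS expn1 (leq_trans (_ : _ <= n * 2)) ?leq_mul //; lia.
  have le_q : 1 + #|T| <= n ^ (1 + #|T|).
    by apply: (@leq_trans (2 ^ (1 + #|T|))); [exact: ltnW (ltn_expl _ _) | rewrite leq_exp2r].
  have -> : n ^ (2 + #|T| + 2 * K.+1) = n ^ (1 + #|T|) * n ^ (2 * K.+1) * n.
    by rewrite -expnD -expnSr.
  rewrite leq_mul2r.
  apply/orP; right; apply: leq_trans (leq_mul le_q le_n).
  by rewrite mulnDl mul1n leq_add2r expn_gt0.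
- by case=> [|t x] y z //= _ /(_ t); rewrite mem_head => /(_ isT).
have eN : embeds (nth 0 s) n N.
  by rewrite -szs; apply: embeds_nth => //; apply/allP => y /sN; rewrite mem_iota.
exists (nth 0 s), (fun x => chi (map (nth 0 s) (rcons x n.-1))); split=> // x y szx xy.
have szx' : size (map (nth 0 s) x) = K.+1 by rewrite size_map.
have yn : y < n by move: xy; rewrite incrE all_rcons => /andP[_ /andP[]]; lia.
have xn1 : incr 0 n (rcons x n.-1).
  move: xy; rewrite -!cats1 !incr_cat /= andbT => /andP[-> /andP[le_y _]] /=; lia.
have inc w : incr 0 n (rcons x w) -> sorted ltn (map (nth 0 s) (rcons x w)).
  by move/(embeds_incr eN); rewrite incrE => /andP[].
rewrite !map_rcons; apply: Hs => //.
- by rewrite -map_rcons; exact: inc.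
- by rewrite -map_rcons; exact: inc.
- move=> _ /mapP[t tx ->] /=; apply: mem_nth; rewrite szs.
  by move: xy; rewrite incrE all_rcons => /andP[_ /andP[_ /allP/(_ t tx)]] /=.
- by apply: mem_nth; rewrite szs; lia.
- by apply: mem_nth; rewrite szs; lia.
Qed.

(** After [K] Erdos-Rado steps single points are left, and the pigeonhole principle has a linear
    bound, hence height 0. *)
Lemma ramsey (T : finType) K :
  forced K (fun N n => forall chi : seq nat -> T, exists2 e, embeds e n N &
    forall x y, size x = K.+1 -> size y = K.+1 -> incr 0 n x -> incr 0 n y ->
      chi (map e x) = chi (map e y)).
Proof.
elim: K => [|K IHK].
  apply: (@forced_linear #|T| 0) => N n; rewrite addn0 => leN chi.
  case: n leN => [|n] leN; first by exists id; [split | case=> [|t x]].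
  have [|c lec] := @pigeonhole T (fun y => chi [:: y]) (iota 0 N) n.+1 (chi [::]) isT.
    by rewrite size_iota.
  set s := [seq y <- _ | _] in lec.
  have [elt eN] : embeds (nth 0 s) (size s) N.
    apply: embeds_nth; last by apply/allP => y; rewrite mem_filter mem_iota => /andP[].
    by apply: sorted_filter; [exact: ltn_trans | exact: iota_ltn_sorted].
  exists (nth 0 s); first by split=> [i j ij|i] jn; [apply: elt | apply: eN]; lia.
  have cE t : t < n.+1 -> chi [:: nth 0 s t] = c.
    by move=> tn; have := mem_nth 0 (leq_trans tn lec); rewrite mem_filter => /andP[/eqP].
  case=> [|t []] // [|u []] //= _ _; rewrite !andbT => tn un.
  by rewrite !cE.
rewrite -add1n; apply: forced_trans (erdos_rado T K) IHK => N M n _ HER HR chi.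
have [e1 [chi' [e1M H1]]] := HER chi.
have [e2 e2n H2] := HR chi'.
exists (e1 \o e2) => [|x y]; first exact: embeds_trans e1M e2n.
case/lastP: x => [//|x x']; case/lastP: y => [//|y y']; rewrite !size_rcons => -[szx] [szy] Hx Hy.
rewrite !(map_comp e1 e2) !(map_rcons e2).
rewrite !H1 ?size_map //; last 2 first.
- by rewrite -map_rcons; exact: embeds_incr e2n Hy.
- by rewrite -map_rcons; exact: embeds_incr e2n Hx.
apply: H2 => //.
- by move: Hx; rewrite -cats1 incr_cat => /andP[].
- by move: Hy; rewrite -cats1 incr_cat => /andP[].
Qed.

(** * Transitive relations *)

Definition trans_below (N : nat) (P : rel nat) : Prop :=
  forall x y z, x < y -> y < z -> z < N -> P x y -> P y z -> P x z.

(** The elements of [A] without a [P]-predecessor in [A] form an antichain. If they are few,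
    induction applies to the others, and a chain found there can be extended by a predecessor of its
    first element. *)
Lemma chain_or_antichain (P : rel nat) a b N A :
  trans_below N P -> sorted ltn A -> all (fun y => y < N) A -> a * b <= size A ->
  exists s, [/\ sorted ltn s, {subset s <= A} &
    (a <= size s) && pairwise P s || (b <= size s) && pairwise (fun x y => ~~ P x y) s].
Proof.
move=> trP; elim: a A => [|a IHa] A sA AN leA; first by exists [::].
pose m y := ~~ has (fun x => (x < y) && P x y) A.
have [leb|ltb] := leqP b (size [seq y <- A | m y]).
  exists [seq y <- A | m y]; split.
  - by apply: sorted_filter => //; exact: ltn_trans.
  - by move=> y; rewrite mem_filter => /andP[].
  rewrite leb /=; apply/orP; right.
  have pA : pairwise ltn [seq y <- A | m y].
    by rewrite -(sorted_pairwise ltn_trans) sorted_filter //; exact: ltn_trans.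
  apply: sub_in_pairwise (allss _) pA => x y /=.
  rewrite !mem_filter => /andP[_ xA] /andP[my _] xy.
  by apply: contra my => Pxy; apply/hasP; exists x; rewrite ?xy.
have [|||s [ss sA' Hs]] := IHa [seq y <- A | ~~ m y].
- by apply: sorted_filter => //; exact: ltn_trans.
- by apply/allP => y; rewrite mem_filter => /andP[_ /(allP AN)].
- move: leA ltb (count_predC m A); rewrite !size_filter mulSn.
  by rewrite -/(predC m); move: (count m A) (count (predC m) A) => c1 c2; lia.
have sA'' : {subset s <= A} by move=> y /sA'; rewrite mem_filter => /andP[].
case/orP: Hs => [/andP[lea cs]|acs]; last by exists s; rewrite acs orbT.
case: s ss sA' sA'' lea cs => [|y s] ss sA' sA'' lea cs.
  (* An empty chain cannot be extended; it occurs only for [a = 0], where one element of [A] is long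
     enough unless [b = 0]. *)
  case: (posnP b) => [->|b0]; first by exists [::]; rewrite orbT.
  exists [:: nth 0 A 0]; split=> [//|y|]; last by rewrite /= andbT ltnS lea.
  by rewrite inE => /eqP->; apply: mem_nth; apply: leq_trans leA; rewrite muln_gt0.
have := sA' y (mem_head _ _); rewrite mem_filter negbK => /andP[/hasP[x xA /andP[xy Pxy]] _].
have sxs : sorted ltn [:: x, y & s] by rewrite /= xy; exact: ss.
exists [:: x, y & s]; split=> //.
  by move=> z; rewrite inE => /orP[/eqP->//|/sA''].
rewrite ltnS lea pairwise_cons cs andbT /= Pxy /=.
rewrite -[X in X || _]andTb; apply/orP; left; rewrite /=.
move: cs; rewrite pairwise_cons => /andP[/allP Py _].
have /allP lty : all (ltn y) s by exact: order_path_min ltn_trans ss.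
apply/allP => z zs; apply: (trP x y z) => //; first exact: lty.
- by apply: (allP AN); apply: sA''; rewrite inE zs orbT.
- exact: Py.
Qed.

(** Chains and antichains are both homogeneous, so transitivity of the complement serves as well as
    that of [P]. *)
Definition tame (N : nat) (P : rel nat) : Prop :=
  trans_below N P \/ trans_below N (fun x y => ~~ P x y).

Definition homogeneous2 (n : nat) (P : rel nat) : Prop :=
  exists b : bool, forall x y, x < y -> y < n -> P x y = b.

Lemma tame_comp n N e P : embeds e n N -> tame N P -> tame n (relpre e P).
Proof.
by move=> [elt eN] [] trP; [left|right] => x y z xy yz zn; apply: trP;
  rewrite ?elt ?eN // (ltn_trans yz).
Qed.

Lemma tame_homogeneous n N P : tame N P -> n * n <= N ->
  exists2 e, embeds e n N & homogeneous2 n (relpre e P).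
Proof.
move=> tP le_N.
have {}tP : exists b : bool, trans_below N (fun x y => P x y == b).
  case: tP => trP; [exists true|exists false] => x y z xy yz zN.
    by rewrite !eqb_id; exact: trP.
  by rewrite !eqbF_neg; exact: trP.
case: tP => b trP.
have [|||s [ss sN Hs]] := @chain_or_antichain _ n n N (iota 0 N) trP.
- exact: iota_ltn_sorted.
- by apply/allP => y; rewrite mem_iota.
- by rewrite size_iota.
have [c [le_s Hc]] : exists c, n <= size s /\ pairwise (fun x y => P x y == c) s.
  case/orP: Hs => /andP[le_s ps]; first by exists b.
  exists (~~ b); split=> //; apply: sub_pairwise ps => x y.
  by case: (P x y); case: (b).
have [elt eN] : embeds (nth 0 s) (size s) N.
  by apply: embeds_nth => //; apply/allP => y /sN; rewrite mem_iota.
exists (nth 0 s); first by split=> [i j ij|i] jn; [apply: elt | apply: eN]; lia.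
exists c => x y xy yn /=; apply/eqP.
by apply: (pairwiseP 0 Hc); rewrite ?inE //; lia.
Qed.

(** Each relation costs one squaring, which affects only the exponent of [n]. *)
Lemma tame_family (B : finType) :
  forced 0 (fun N n => forall P : B -> rel nat, (forall b, tame N (P b)) ->
    exists2 e, embeds e n N & forall b, homogeneous2 n (relpre e (P b))).
Proof.
exists (2 ^ #|B|) => [|n N n2 leN P tP]; first by rewrite expn_gt0.
suff [e eN He] : exists2 e, embeds e n N &
    forall b, b \in enum B -> homogeneous2 n (relpre e (P b)).
  by exists e => // b; apply: He; rewrite mem_enum.
move: leN; rewrite cardE /=; elim: (enum B) N P tP => [|b l IHl] N P tP leN.
  by exists id => //; split=> // i; move/leq_trans; apply.
have [|e1 e1N hb] := @tame_homogeneous (n ^ 2 ^ size l) N (P b) (tP b).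
  by move: leN; rewrite /= expnS mul2n -addnn expnD.
have [b'||e2 e2N He2] := IHl (n ^ 2 ^ size l) (fun b => relpre e1 (P b)).
- exact: tame_comp e1N (tP b').
- by [].
exists (e1 \o e2); first exact: embeds_trans e1N e2N.
move=> b'; rewrite inE => /orP[/eqP->|/He2//].
case: hb => c Hc; exists c => x y xy yn /=; case: e2N => elt eN.
by apply: Hc; [exact: elt | exact: eN].
Qed.

(** * Mixed differences *)

Local Open Scope ring_scope.

(** [b] lists the ends [p_1, q_1, p_2, q_2, ...] of the sides of a box; [pbox]
    takes differences in the first points only. *)
Fixpoint pbox (R : zmodType) (b : seq nat) (g : seq nat -> R) : seq nat -> R :=
  if b is p :: q :: b' then pbox b' (fun w => g (q :: w) - g (p :: w)) else g.

Definition box (R : zmodType) (b : seq nat) (g : seq nat -> R) : R := pbox b g [::].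

Lemma seq_ind2step (T : Type) (P : seq T -> Prop) :
  P [::] -> (forall x, P [:: x]) -> (forall x y s, P s -> P [:: x, y & s]) ->
  forall s, P s.
Proof.
move=> P0 P1 P2 s; suff [] : P s /\ forall x, P (x :: s) by [].
elim: s => [|x s [IH1 IH2]]; first by split.
by split=> [|y]; [exact: IH2 | exact: P2].
Qed.

Lemma eq_pbox (R : zmodType) b (g h : seq nat -> R) : g =1 h -> pbox b g =1 pbox b h.
Proof.
elim/seq_ind2step: b g h => [|p|p q b IHb] g h eq_gh //=.
by apply: IHb => w; rewrite !eq_gh.
Qed.

Lemma pboxB (R : zmodType) b (g h : seq nat -> R) w :
  pbox b (fun w => g w - h w) w = pbox b g w - pbox b h w.
Proof.
elim/seq_ind2step: b g h => [|p|p q b IHb] g h //=.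
by rewrite -IHb; apply: eq_pbox => z; rewrite !opprD !opprK addrACA.
Qed.

Lemma pbox_cat (R : zmodType) u v (g : seq nat -> R) :
  ~~ odd (size u) -> pbox (u ++ v) g = pbox v (pbox u g).
Proof.
elim/seq_ind2step: u g => [|p|p q u IHu] g //=; rewrite negbK => ou.
exact: IHu.
Qed.

(** One and the same function is evaluated at the two ends of a side; hence boxes are additive along
    every side. *)
Lemma box_slot (R : zmodType) u p q v (g : seq nat -> R) : ~~ odd (size u) ->
  box (u ++ p :: q :: v) g =
  box v (fun w => pbox u g (q :: w)) - box v (fun w => pbox u g (p :: w)).
Proof. by move=> ou; rewrite /box pbox_cat //= pboxB. Qed.

(** The unit box with lower corner [z], in the format of [pbox]. *)
Definition dbl (z : seq nat) : seq nat := flatten [seq [:: t; t.+1] | t <- z].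

Lemma size_dbl z : size (dbl z) = (size z).*2.
Proof. by elim: z => //= t z ->. Qed.

Lemma dbl_cat u v : dbl (u ++ v) = dbl u ++ dbl v.
Proof. by rewrite /dbl map_cat flatten_cat. Qed.

Definition del (T : Type) (i : nat) (x : seq T) : seq T := take i x ++ drop i.+1 x.

Lemma del0 (T : Type) (y : T) x : del 0 (y :: x) = x.
Proof. by rewrite /del /= drop0. Qed.

Lemma delS (T : Type) i (y : T) x : del i.+1 (y :: x) = y :: del i x.
Proof. by []. Qed.

Lemma sum_ord_recl (R : nmodType) n (F : nat -> R) :
  \sum_(i < n.+1) F i = F 0%N + \sum_(i < n) F i.+1.
Proof. by rewrite big_ord_recl. Qed.

Lemma map_del (T S : Type) (f : T -> S) i x : map f (del i x) = del i (map f x).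
Proof. by rewrite /del map_cat map_take map_drop. Qed.

(** Sum of [M z] over the [z] with gaps at least 2 such that [z_i < x_i] when
    [eps_i] holds and [x_i <= z_i] otherwise. *)
Fixpoint region_sum (R : nmodType) (eps : seq bool) (a n : nat)
    (M : seq nat -> R) (x : seq nat) : R :=
  match eps, x with
  | e :: eps', y :: x' =>
    if e then \sum_(a <= t < y) region_sum eps' t.+2 n (fun w => M (t :: w)) x'
    else \sum_(y <= t < (head n x').-1)
           region_sum eps' t.+2 n (fun w => M (t :: w)) x'
  | _, _ => M [::]
  end.

Lemma incr_head a a' n x : incr a n x -> (a' <= head n x)%N -> incr a' n x.
Proof. by case: x => [//|y x] /= /and3P[_ -> ->] ->. Qed.

(** Telescoping in one coordinate after the other recovers [g] from its unit mixed differences. The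
    boundary values that arise miss one of the points, and every coordinate summed upwards from [x]
    reverses the sign. *)
Lemma region_sum_decomp (R : realFieldType) eps a n (g : seq nat -> R) :
  exists b : nat -> seq nat -> R, forall x, size x = size eps -> incr a n x ->
    g x = (-1) ^+ count negb eps * region_sum eps a n (fun z => box (dbl z) g) x
          + \sum_(i < size eps) b i (del i x).
Proof.
elim: eps a g => [|e eps IH] a g.
  by exists (fun _ _ => 0) => -[|//] _ _; rewrite big_ord0 addr0 mul1r.
have [b Hb] := choice (fun t => IH t.+2 (fun w => g (t.+1 :: w) - g (t :: w))).
(* Telescope in the first coordinate and expand each increment by the induction hypothesis. *)
have tele c d x : (c <= d)%N -> size x = size eps ->
    (forall t, (c <= t < d)%N -> incr t.+2 n x) ->
    g (d :: x) = g (c :: x)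
      + (-1) ^+ count negb eps * (\sum_(c <= t < d)
           region_sum eps t.+2 n (fun z => box (dbl (t :: z)) g) x)
      + \sum_(i < size eps) \sum_(c <= t < d) b t i (del i x).
  move=> le_cd szx Hx; rewrite exchange_big /= mulr_sumr -addrA -big_split /=.
  rewrite -[LHS](subrKC (g (c :: x))); congr (_ + _).
  rewrite -(telescope_sumr (fun t => g (t :: x))) //.
  by apply: eq_big_nat => t /Hx; exact: Hb.
case: e.
  pose b' i w := if i is i'.+1
    then \sum_(a <= t < head 0%N w) b t i' (behead w) else g (a :: w).
  exists b'.
  case=> [//|y x] /= [szx] /and3P[ay yn ix].
  rewrite (sum_ord_recl _ (fun i => b' i (del i (y :: x)))).
  rewrite del0 {1}/b' (tele a y) //; last first.
    by move=> t /andP[_ ty]; apply: incr_weaken ix.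
  by rewrite -addrA addrCA.
have lastE y x : (y < n)%N -> incr y.+1 n x -> (y <= (head n x).-1)%N.
  by move=> yn; case: x => [|z x] /=; first lia; move=> /and3P[]; lia.
case: eps b {IH} Hb tele => [|e eps] b Hb tele.
  exists (fun i w => g (n.-1 :: w)).
  case=> [//|y [|//]] /= _ /and3P[ay yn ix].
  rewrite big_ord1 /= (tele y n.-1 [::]) //; last by have := lastE y [::] yn ix.
  by rewrite big_ord0 addr0 addn0 expr1 mul1r mulN1r [g _ + _]addrC addKr.
(* The sum over [y <= t < x0.-1] of a function of [t] and of the points after [x0]
   is the difference of a term without [y] and a term without [x0]. *)
pose b' i w := match i with
  | 0%N => g ((head n w).-1 :: w)
           - \sum_(0 <= t < (head n w).-1) b t 0%N (behead w)
  | 1%N => \sum_(0 <= t < head 0%N w) b t 0%N (behead w)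
  | i'.+2 => - \sum_(head 0%N w <= t < (head n (behead w)).-1) b t i'.+1 (behead w)
  end.
exists b'.
case=> [//|y [//|x0 x]] [szx] /= /and3P[ay yn /and3P[y0 x0n ix]].
have le_y : (y <= x0.-1)%N by lia.
have := tele y x0.-1 (x0 :: x) le_y (congr1 S szx).
rewrite [size (e :: eps)]/= (sum_ord_recl _ (fun i => \sum_(y <= t < x0.-1) b t i (del i (x0 :: x)))).
rewrite del0 => H.
rewrite (sum_ord_recl _ (fun i => b' i (del i [:: y, x0 & x]))) del0.
rewrite (sum_ord_recl _ (fun i => b' i.+1 (del i.+1 [:: y, x0 & x]))) delS del0.
rewrite {1}/b' [head _ _]/= H; last by move=> t /andP[_ tx] /=; rewrite x0n ix; lia.
rewrite /b' /=.
rewrite sumrN exprS mulN1r.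
rewrite (@big_cat_nat _ _ _ y 0%N x0.-1) //= mulNr.
ring.
Qed.

(** * Region sums of geometrically varying atoms *)

Lemma geometric_sum_up (R : realFieldType) (C : R) (F : nat -> R) a y :
  2 <= C -> (a <= y)%N -> (forall t, (a <= t <= y)%N -> 0 <= F t) ->
  (forall t, (a <= t < y)%N -> C * F t <= F t.+1) ->
  \sum_(a <= t < y.+1) F t <= 2 * F y.
Proof.
move=> C2 ay; rewrite -(subnKC ay); elim: (y - a)%N => [|k IHk] F0 FC.
  by rewrite addn0 big_nat1; have := F0 a; rewrite addn0 leqnn => /(_ isT); lra.
rewrite big_nat_recr /=; last by lia.
have H1 := F0 (a + k)%N ltac:(lia); have H2 := FC (a + k)%N ltac:(lia).
have H3 : 2 * F (a + k)%N <= C * F (a + k)%N by rewrite ler_wpM2r.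
have H : \sum_(a <= t < (a + k).+1) F t <= 2 * F (a + k)%N.
  by apply: IHk => t Ht; [apply: F0 | apply: FC]; lia.
by rewrite addnS; lra.
Qed.

Lemma geometric_sum_down (R : realFieldType) (C : R) (F : nat -> R) y z :
  2 <= C -> (y < z)%N -> (forall t, (y <= t < z)%N -> 0 <= F t) ->
  (forall t, (y <= t)%N -> (t.+1 < z)%N -> C * F t.+1 <= F t) ->
  \sum_(y <= t < z) F t <= 2 * F y.
Proof.
move=> C2 yz; rewrite -(subnKC (ltnW yz)).
have : (0 < z - y)%N by lia.
case: (z - y)%N => [//|k] _; elim: k y {yz} => [|k IHk] y F0 FC.
  by rewrite addn1 big_nat1; have := F0 y ltac:(lia); lra.
rewrite big_ltn; last by lia.
have H1 := F0 y.+1 ltac:(lia); have H2 := FC y ltac:(lia) ltac:(lia).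
have H3 : 2 * F y.+1 <= C * F y.+1 by rewrite ler_wpM2r.
have H : \sum_(y.+1 <= t < y.+1 + k.+1) F t <= 2 * F y.+1.
  by apply: IHk => t *; [apply: F0 | apply: FC]; lia.
by rewrite addnS -addSn; lra.
Qed.

(** The place of the atom nearest to [x] in every coordinate of the region, which is the largest one
    when the atoms are geometric. *)
Definition spaced_corner (eps : seq bool) (x : seq nat) : seq nat :=
  [seq if p.1 then p.2.-1 else p.2 | p <- zip eps x].

(** The gaps leave room at each point for either of the unit sides from [y.-1] to [y] and from [y]
    to [y.+1], without meeting those at the neighbouring points. *)
Fixpoint spaced (a n : nat) (x : seq nat) : bool :=
  if x is y :: x' then [&& a < y, y.+1 < n & spaced y.+2 n x']%N else true.

Lemma spaced_weaken a a' n x : (a' <= a)%N -> spaced a n x -> spaced a' n x.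
Proof. by case: x => [//|y x] /= le_a /and3P[ay -> ->]; rewrite (leq_ltn_trans le_a ay). Qed.

Lemma spaced_corner_incr eps a n x : size x = size eps -> spaced a n x ->
  incr a n (dbl (spaced_corner eps x)).
Proof.
elim: eps a x => [|e eps IH] a [|y x] //= [szx] /and3P[ay yn sx].
have := IH y.+2 x szx sx.
case: e => Hi.
  by rewrite (incr_weaken _ _ Hi) //; lia.
by rewrite Hi; lia.
Qed.

Definition nneg_atoms (R : realFieldType) k a n (M : seq nat -> R) : Prop :=
  forall z, size z = k -> incr a n (dbl z) -> 0 <= M z.

(** Atoms grow along a coordinate where [eps] is true, and there [region_sum] sums below [x]; so the
    region lies on the small side. *)
Definition geometric_atoms (R : realFieldType) (C : R) eps a n (M : seq nat -> R) : Prop :=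
  forall u v t, (size u + (size v).+1)%N = size eps ->
    incr a n (dbl (u ++ t :: v)) -> incr a n (dbl (u ++ t.+1 :: v)) ->
    if nth true eps (size u) then C * M (u ++ t :: v) <= M (u ++ t.+1 :: v)
    else C * M (u ++ t.+1 :: v) <= M (u ++ t :: v).

Lemma nneg_atoms_cons (R : realFieldType) k a n (M : seq nat -> R) t :
  (a <= t)%N -> (t.+1 < n)%N -> nneg_atoms k.+1 a n M ->
  nneg_atoms k t.+2 n (fun w => M (t :: w)).
Proof. by move=> at_ tn M0 z sz Hz; apply: M0 => /=; [rewrite sz | rewrite at_ Hz tn leqnn (ltnW tn)]. Qed.

Lemma geometric_atoms_cons (R : realFieldType) (C : R) e eps a n M t :
  (a <= t)%N -> (t.+1 < n)%N -> geometric_atoms C (e :: eps) a n M ->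
  geometric_atoms C eps t.+2 n (fun w => M (t :: w)).
Proof.
move=> at_ tn HM u v s sz H1 H2.
by apply: (HM (t :: u) v s) => /=; [rewrite -sz | rewrite at_ H1 tn leqnn (ltnW tn) | rewrite at_ H2 tn leqnn (ltnW tn)].
Qed.


Lemma region_sum_ge0 (R : realFieldType) eps a n (M : seq nat -> R) x :
  nneg_atoms (size eps) a n M -> size x = size eps -> incr a n x ->
  0 <= region_sum eps a n M x.
Proof.
elim: eps a M x => [|e eps IH] a M [|y x] //= M0; first by move=> _ _; exact: M0.
case=> szx /and3P[ay yn ix].
have hn : ((head n x).-1 < n)%N.
  by case: (x) ix => [_|z w /= /and3P[_ zn _]] /=; lia.
have pos t : (a <= t)%N -> (t.+1 < n)%N -> incr t.+2 n x ->
    0 <= region_sum eps t.+2 n (fun w => M (t :: w)) x.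
  by move=> at_ tn; apply: IH => //; exact: nneg_atoms_cons M0.
case: e {IH M0}; rewrite big_nat_cond sumr_ge0 // => t; rewrite andbT => /andP[H1 H2].
  by apply: pos => //; [exact: leq_ltn_trans H2 yn | exact: incr_weaken ix].
by apply: pos; [exact: leq_trans H1 | lia | apply: incr_head ix _; lia].
Qed.

(** Two lower limits are allowed because the inner sums for [t] and [t.+1] start at different
    places; the region for the larger limit is contained in the other. *)
Lemma region_sum_mono (R : realFieldType) (c : R) eps a1 a2 n M1 M2 x :
  0 <= c -> (a2 <= a1)%N -> nneg_atoms (size eps) a2 n M2 ->
  (forall z, size z = size eps -> incr a1 n (dbl z) -> M1 z <= c * M2 z) ->
  size x = size eps -> incr a1 n x ->
  region_sum eps a1 n M1 x <= c * region_sum eps a2 n M2 x.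
Proof.
move=> c0; elim: eps a1 a2 M1 M2 x => [|e eps IH] a1 a2 M1 M2 [|y x] //= le_a M20 M12.
  by move=> _ _; exact: M12.
case=> szx /and3P[ay yn ix].
have hn : ((head n x).-1 < n)%N.
  by case: (x) ix => [_|z w /= /and3P[_ zn _]] /=; lia.
have mono t : (a1 <= t)%N -> (t.+1 < n)%N -> incr t.+2 n x ->
    region_sum eps t.+2 n (fun w => M1 (t :: w)) x <=
    c * region_sum eps t.+2 n (fun w => M2 (t :: w)) x.
  move=> at_ tn it; apply: IH => //.
    by apply: nneg_atoms_cons M20 => //; exact: leq_trans at_.
  by move=> z sz iz; apply: M12 => /=; [rewrite sz | rewrite at_ iz tn leqnn (ltnW tn)].
case: e {IH M12} M20 => M20; rewrite mulr_sumr.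
  rewrite [leRHS](@big_cat_nat _ _ _ a1) //=.
  apply: (@le_trans _ _ (\sum_(a1 <= t < y) c * region_sum eps t.+2 n (fun w => M2 (t :: w)) x)).
    apply: ler_sum_nat => t /andP[H1 H2]; apply: mono => //; last exact: incr_weaken ix.
    exact: leq_ltn_trans yn.
  rewrite lerDr big_nat_cond sumr_ge0 // => t; rewrite andbT => /andP[H1 H2].
  rewrite mulr_ge0 // region_sum_ge0 //.
    by apply: nneg_atoms_cons M20 => //; lia.
  by apply: incr_weaken ix => //; lia.
apply: ler_sum_nat => t /andP[H1 H2].
by apply: mono; [exact: leq_trans H1 | lia | apply: incr_head ix _; lia].
Qed.

Lemma spaced_incr a n x : spaced a n x -> incr a n x.
Proof.
elim: x a => [//|y x IHx] a /= /and3P[ay yn /IHx ix].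
by rewrite (ltnW ay) (ltnW yn) (incr_weaken _ _ ix).
Qed.

Lemma spaced_head y n x : (y.+1 < n)%N -> spaced y.+2 n x -> (y.+1 < head n x)%N.
Proof. by case: x => //= z x _ /andP[/ltnW]. Qed.

Lemma region_sum_ge_corner (R : realFieldType) eps a n (M : seq nat -> R) x :
  nneg_atoms (size eps) a n M -> size x = size eps -> spaced a n x ->
  M (spaced_corner eps x) <= region_sum eps a n M x.
Proof.
elim: eps a M x => [|e eps IH] a M [|y x] //= M0 [szx] /and3P[ay yn sx].
have pos t : (a <= t)%N -> (t.+1 < n)%N -> incr t.+2 n x ->
    0 <= region_sum eps t.+2 n (fun w => M (t :: w)) x.
  by move=> at_ tn it; apply: region_sum_ge0 => //; exact: nneg_atoms_cons M0.
have ix := spaced_incr sx.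
have hx := spaced_head yn sx.
have hn : ((head n x).-1 < n)%N.
  by case: (x) ix => [_|z w /= /and3P[_ zn _]] /=; lia.
case: e.
  case: y ay yn sx ix hx => [//|y] ay yn sx ix hx.
  rewrite big_nat_recr //= ler_wpDl //.
    rewrite big_nat_cond sumr_ge0 // => t; rewrite andbT => /andP[H1 H2].
    by apply: pos => //; [lia | apply: incr_weaken ix => //; lia].
  apply: (IH _ (fun w => M (y :: w))) => //; last exact: spaced_weaken sx.
  by apply: nneg_atoms_cons M0 => //; lia.
rewrite big_ltn; last by lia.
rewrite ler_wpDr //.
  rewrite big_nat_cond sumr_ge0 // => t; rewrite andbT => /andP[H1 H2].
  by apply: pos; [lia | lia | apply: incr_head ix _; lia].
apply: (IH _ (fun w => M (y :: w))) => //.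
by apply: nneg_atoms_cons M0 => //; lia.
Qed.

(** Each coordinate contributes a geometric sum, which is at most twice its largest term. *)
Lemma region_sum_le_corner (R : realFieldType) (C : R) eps a n (M : seq nat -> R) x :
  2 <= C -> nneg_atoms (size eps) a n M -> geometric_atoms C eps a n M ->
  size x = size eps -> spaced a n x ->
  region_sum eps a n M x <= 2 ^+ size eps * M (spaced_corner eps x).
Proof.
move=> C2; elim: eps a M x => [|e eps IH] a M [|y x] //= M0 MC.
  by rewrite expr0 mul1r.
case=> szx /and3P[ay yn sx].
have ix := spaced_incr sx.
have hx := spaced_head yn sx.
have hn : ((head n x).-1 < n)%N.
  by case: (x) ix => [_|z w /= /and3P[_ zn _]] /=; lia.
have IHt t : (a <= t)%N -> (t <= y)%N -> region_sum eps t.+2 n (fun w => M (t :: w)) x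
    <= 2 ^+ size eps * M (t :: spaced_corner eps x).
  move=> at_ ty; apply: (IH _ (fun w => M (t :: w))) => //.
  - by apply: nneg_atoms_cons M0 => //; lia.
  - by apply: geometric_atoms_cons MC => //; lia.
  - by apply: spaced_weaken sx; lia.
have ic t : (a <= t)%N -> (t <= y)%N -> incr a n (dbl (t :: spaced_corner eps x)).
  move=> at_ ty /=; rewrite at_ leqnn (incr_weaken _ _ (spaced_corner_incr szx sx)) //; lia.
have szc : size (spaced_corner eps x) = size eps by rewrite size_map size_zip szx minnn.
(* The range of the inner sum shrinks as [t] grows. For growing atoms this works against a
   comparison of inner sums, so each is first bounded by its corner atom; for decaying atoms the
   inner sums are compared directly. *)
rewrite exprSr -mulrA; case: e IH M0 MC => IH M0 MC.
  case: y ay yn sx ix hx IHt ic => [//|y] ay yn sx ix hx IHt ic.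
  apply: (@le_trans _ _ (\sum_(a <= t < y.+1) 2 ^+ size eps * M (t :: spaced_corner eps x))).
    by apply: ler_sum_nat => t /andP[H1 H2]; apply: IHt => //; lia.
  rewrite -mulr_sumr ler_pM2l ?exprn_gt0 //.
  apply: (geometric_sum_up C2) => // t /andP[H1 H2].
    by apply: M0; [rewrite /= szc | apply: ic => //; lia].
  by apply: (MC [::] (spaced_corner eps x) t); rewrite /= ?szc //; apply: ic => //; lia.
have C0 : 0 < C by lra.
have posC t : (y <= t)%N -> (t.+1 < head n x)%N -> 0 <= region_sum eps t.+2 n (fun w => M (t :: w)) x.
  move=> yt tx; apply: region_sum_ge0 => //; last by apply: incr_head ix _.
  by apply: nneg_atoms_cons M0; lia.
apply: le_trans (geometric_sum_down C2 _ _ _) _.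
- by lia.
- by move=> t /andP[H1 H2]; apply: posC => //; lia.
- move=> t yt tx; rewrite -ler_pdivlMl //.
  apply: region_sum_mono => //.
  + by rewrite invr_ge0 ltW.
  + by apply: nneg_atoms_cons M0; lia.
  + move=> z sz iz; rewrite ler_pdivlMl //.
    apply: (MC [::] z t) => /=; first by rewrite sz.
      by rewrite (incr_weaken _ _ iz) //; lia.
    by rewrite iz; lia.
  + by apply: incr_head ix _; lia.
by rewrite mulrCA ler_pM2l // IHt // ltnW.
Qed.

Lemma incr_dbl_between a n u v t s t' : (t <= s)%N -> (s <= t')%N ->
  incr a n (dbl (u ++ t :: v)) -> incr a n (dbl (u ++ t' :: v)) ->
  incr a n (dbl (u ++ s :: v)).
Proof.
have dbl_cons w z : dbl (w :: z) = [:: w, w.+1 & dbl z] by [].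
move=> ts st'; rewrite !dbl_cat !dbl_cons !incr_cat.
case/andP=> -> /and3P[H1 H2 /and3P[H3 H4 H5]].
case/andP=> _ /and3P[G1 G2 /and3P[G3 G4 G5]] /=.
by rewrite leqnn (incr_weaken _ _ G5) //; lia.
Qed.

Lemma geometric_atoms_chain (R : realFieldType) (C : R) eps a n M u v t t' :
  1 <= C -> nneg_atoms (size eps) a n M -> geometric_atoms C eps a n M ->
  (size u + (size v).+1)%N = size eps -> (t < t')%N ->
  incr a n (dbl (u ++ t :: v)) -> incr a n (dbl (u ++ t' :: v)) ->
  if nth true eps (size u) then C * M (u ++ t :: v) <= M (u ++ t' :: v)
  else C * M (u ++ t' :: v) <= M (u ++ t :: v).
Proof.
move=> C1 M0 MC sz; elim: t' => [//|t' IH]; rewrite ltnS leq_eqVlt => /orP[/eqP->|tt'] H H'.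
  exact: MC.
have H1 : incr a n (dbl (u ++ t' :: v)) by apply: incr_dbl_between H H'; lia.
have := IH tt' H H1; have := MC u v t' sz H1 H'.
have Mt' : 0 <= M (u ++ t' :: v) by apply: M0; rewrite ?size_cat.
have CM : M (u ++ t' :: v) <= C * M (u ++ t' :: v) by rewrite ler_peMl.
by case: nth => G1 G2; [exact: le_trans G2 (le_trans CM G1) | exact: le_trans G1 (le_trans CM G2)].
Qed.

Lemma spaced_corner_slot eps u y v : (size u < size eps)%N ->
  spaced_corner eps (u ++ y :: v) =
  spaced_corner (take (size u) eps) u ++ (if nth true eps (size u) then y.-1 else y)
    :: spaced_corner (drop (size u).+1 eps) v.
Proof.
move=> lt_u; rewrite /spaced_corner -{1}(cat_take_drop (size u) eps) zip_cat; last first.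
  by rewrite size_take lt_u.
by rewrite map_cat (drop_nth true lt_u).
Qed.

Lemma spaced_gt0 a n x : spaced a n x -> all (fun y => 0 < y)%N x.
Proof.
elim: x a => [//|y x IHx] a /= /and3P[ay _ /IHx->].
by rewrite andbT (leq_ltn_trans _ ay).
Qed.

(** The region sum lies between its corner atom and [2 ^+ size eps] times it, so the factor [C] of
    the corner atoms survives up to this loss. *)
Lemma region_sum_rapid (R : realFieldType) (C : R) eps a n M u v y y' :
  2 <= C -> nneg_atoms (size eps) a n M -> geometric_atoms C eps a n M ->
  (size u + (size v).+1)%N = size eps -> (y < y')%N ->
  spaced a n (u ++ y :: v) -> spaced a n (u ++ y' :: v) ->
  let U := region_sum eps a n M in
  if nth true eps (size u) then C / 2 ^+ size eps * U (u ++ y :: v) <= U (u ++ y' :: v)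
  else C / 2 ^+ size eps * U (u ++ y' :: v) <= U (u ++ y :: v).
Proof.
move=> C2 M0 MC sz yy' sy sy' /=.
have szx t : size (u ++ t :: v) = size eps by rewrite size_cat.
have lt_u : (size u < size eps)%N by rewrite -sz -addSnnS leq_addr.
have D0 : (0 : R) < 2 ^+ size eps by rewrite exprn_gt0.
have C0 : 0 <= C by lra.
have step t t' : spaced a n (u ++ t :: v) -> spaced a n (u ++ t' :: v) ->
    C * M (spaced_corner eps (u ++ t :: v)) <= M (spaced_corner eps (u ++ t' :: v)) ->
    C / 2 ^+ size eps * region_sum eps a n M (u ++ t :: v)
      <= region_sum eps a n M (u ++ t' :: v).
  move=> st st' H; apply: le_trans (region_sum_ge_corner M0 (szx t') st').
  apply: le_trans H; rewrite mulrAC ler_pdivrMr // -mulrA ler_wpM2l // [leRHS]mulrC.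
  exact: region_sum_le_corner C2 M0 MC (szx t) st.
have ic t : spaced a n (u ++ t :: v) -> incr a n (dbl (spaced_corner eps (u ++ t :: v))).
  by move=> st; apply: spaced_corner_incr.
have szc e' z : size (spaced_corner e' z) = minn (size e') (size z) by rewrite size_map size_zip.
have := ic _ sy; have := ic _ sy'; rewrite !spaced_corner_slot //.
set cu := spaced_corner _ u; set cv := spaced_corner _ v.
have szcu : size cu = size u by rewrite szc size_take lt_u minnn.
have szcv : (size cu + (size cv).+1)%N = size eps by rewrite szcu szc size_drop; lia.
have C1 : 1 <= C by lra.
have step' := geometric_atoms_chain C1 M0 MC szcv; rewrite szcu in step'.
move: step'; case E: (nth _ _ _) => step' H' H; apply: step => //; rewrite !spaced_corner_slot // E -/cu -/cv.
  apply: step' => //.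
  (* Positivity of [y] keeps the truncated predecessors of [y] and [y'] distinct. *)
  have y0 : (0 < y)%N by have := spaced_gt0 sy; rewrite all_cat /= => /and3P[].
  by lia.
exact: step'.
Qed.

(** * Growth or decay of mixed differences *)

Lemma no_balanced_increments (R : realFieldType) (C : R) J (Y : nat -> R) :
  0 < C -> C * C <= J%:R ->
  (forall p q, (p < q <= J.+1)%N -> Y p < Y q) ->
  ~ (forall p q r, (p < q)%N -> (q < r <= J.+1)%N ->
      Y r - Y q < C * (Y q - Y p) /\ Y q - Y p < C * (Y r - Y q)).
Proof.
move=> C0 CJ Ylt bal.
have J0 : (0 < J)%N by rewrite -(ltr_nat R) (lt_le_trans _ CJ) // mulr_gt0.
have D0 : 0 < Y 1%N - Y 0%N by rewrite subr_gt0 Ylt.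
(* Each later unit increment exceeds a [C]-th of the increment from 0 up to it, hence of the first
   one. Then [J >= C * C] of them add up to at least [C] times the first, more than the balance at
   the points 0, 1, [J.+1] permits. *)
have H j : (j <= J)%N -> j%:R * (Y 1%N - Y 0%N) <= C * (Y j.+1 - Y 1%N).
  elim: j => [|j IHj] jJ; first by rewrite mul0r subrr mulr0.
  have := IHj (ltnW jJ).
  have [_] := bal 0%N j.+1 j.+2 isT ltac:(lia).
  have : Y 1%N <= Y j.+1 by case: j jJ {IHj} => [//|j] jJ; rewrite ltW // Ylt; lia.
  by rewrite -natr1; lra.
have [H1 _] := bal 0%N 1%N J.+1 isT ltac:(lia).
have := H J (leqnn J).
have : C * (Y J.+1 - Y 1%N) < C * (C * (Y 1%N - Y 0%N)) by rewrite ltr_pM2l.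
rewrite mulrA; have : C * C * (Y 1%N - Y 0%N) <= J%:R * (Y 1%N - Y 0%N) by rewrite ler_pM2r.
by lra.
Qed.

(** The first [k.*2] points give the sign of a box. Deleting point [i.*2.+2] or point [i.*2] leaves
    two boxes that are neighbours along coordinate [i]; both comparisons of their sizes are
    recorded. *)
Definition box_type (R : realFieldType) (C : R) k (g : seq nat -> R) (w : seq nat) :
    (bool * bool) * {ffun 'I_k -> bool * bool} :=
  ((0 < box (take k.*2 w) g, box (take k.*2 w) g < 0),
   [ffun i : 'I_k =>
     (C * `|box (del i.*2.+2 w) g| <= `|box (del i.*2 w) g|,
      C * `|box (del i.*2 w) g| <= `|box (del i.*2.+2 w) g|)]).

Definition box_homogeneous (R : realFieldType) (C : R) k n (g : seq nat -> R) : Prop :=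
  forall w w', size w = k.*2.+1 -> size w' = k.*2.+1 ->
    incr 0 n w -> incr 0 n w' -> box_type C k g w = box_type C k g w'.

Lemma del_slot2 (T : Type) (u v : seq T) p q r :
  del (size u).+2 (u ++ [:: p, q, r & v]) = u ++ [:: p, q & v].
Proof. by elim: u => [|t u IHu] /=; [rewrite /del /= drop0 | rewrite delS IHu]. Qed.

Lemma del_slot0 (T : Type) (u v : seq T) p : del (size u) (u ++ p :: v) = u ++ v.
Proof. by elim: u => [|t u IHu] /=; [rewrite del0 | rewrite delS IHu]. Qed.

Lemma incr_iota_cat n m w : (m <= n)%N -> incr 0 n (iota 0 m ++ w) = incr m n w.
Proof.
move=> mn; rewrite incr_cat incr_iota //=.
suff -> : forall a, last a (map S (iota a m)) = (a + m)%N by [].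
by elim: m {mn} => [|m IHm] a /=; rewrite ?addn0 // IHm addSnnS.
Qed.

(** If neither growth nor decay held along a coordinate, homogeneity would make all neighbouring
    boxes there comparable within a factor [C], against [no_balanced_increments]. *)
Lemma box_homogeneous_dichotomy (R : realFieldType) (C : R) J k n g :
  0 < C -> C * C <= J%:R -> (k.*2 + J + 3 <= n)%N -> box_homogeneous C k n g ->
  (forall b, size b = k.*2 -> incr 0 n.-1 b -> box b g = 0) \/
  exists (s : bool) (eps : seq bool), [/\ size eps = k,
    forall b, size b = k.*2 -> incr 0 n.-1 b -> 0 < (-1) ^+ s * box b g &
    forall u p q r v, ~~ odd (size u) -> (size u + size v)%N.+2 = k.*2 ->
      incr 0 n (u ++ [:: p, q, r & v]) ->
      if nth true eps (size u)./2
      then C * `|box (u ++ [:: p, q & v]) g| <= `|box (u ++ [:: q, r & v]) g|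
      else C * `|box (u ++ [:: q, r & v]) g| <= `|box (u ++ [:: p, q & v]) g| ].
Proof.
move=> C0 CJ le_n hom.
pose w0 := iota 0 k.*2.+1.
have sw0 : size w0 = k.*2.+1 by rewrite size_iota.
have iw0 : incr 0 n w0 by apply: incr_iota; lia.
(* A box has one point less than a coloured tuple; [n.-1] is appended, which is why boxes are
   confined below [n.-1]. *)
have sgn b : size b = k.*2 -> incr 0 n.-1 b ->
    (0 < box b g, box b g < 0) = (box_type C k g w0).1.
  move=> szb ib; rewrite (hom w0 (rcons b n.-1)) ?size_rcons ?szb //.
    by rewrite /= -cats1 take_cat szb ltnn subnn /= cats0.
  rewrite -cats1 incr_cat (incr_weaken _ _ ib) //=; last by lia.
  rewrite andbT andbC; apply/andP; split; first by lia.
  case/lastP: b {szb} ib => [//|b z]; rewrite incrE all_rcons map_rcons last_rcons.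
  by case/andP=> _ /andP[]; lia.
have [zero|[s sgn_s]] : (forall b, size b = k.*2 -> incr 0 n.-1 b -> box b g = 0) \/
    exists s : bool, forall b, size b = k.*2 -> incr 0 n.-1 b -> 0 < (-1) ^+ s * box b g.
  case E : (box_type C k g w0).1 sgn => [[] neg] sgn.
    right; exists false => b szb ib; rewrite mul1r.
    by have [->] := sgn b szb ib.
  case: neg {E} sgn => sgn; [right; exists true | left] => b szb ib.
    by rewrite mulN1r oppr_gt0; have [_ ->] := sgn b szb ib.
  by have [] := sgn b szb ib; case: (ltrgtP 0 (box b g)).
- by left.
right; exists s, (mkseq (fun i => C * `|box (del i.*2.+2 w0) g| <= `|box (del i.*2 w0) g|) k).
split; rewrite ?size_mkseq //.
move=> u p q r v ou szk iw.
have szw : size (u ++ [:: p, q, r & v]) = k.*2.+1 by rewrite -szk size_cat /= !addnS.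
have eu : (size u)./2.*2 = size u by rewrite -[RHS]odd_double_half (negbTE ou).
have lt_u : ((size u)./2 < k)%N by lia.
rewrite nth_mkseq //.
have bits a p' q' r' b : size a = size u -> size b = size v ->
    incr 0 n (a ++ [:: p', q', r' & b]) ->
  (C * `|box (a ++ [:: p', q' & b]) g| <= `|box (a ++ [:: q', r' & b]) g|,
   C * `|box (a ++ [:: q', r' & b]) g| <= `|box (a ++ [:: p', q' & b]) g|) =
  (box_type C k g w0).2 (Ordinal lt_u).
  move=> sza szb iab; rewrite (hom w0 (a ++ [:: p', q', r' & b])) //; last first.
    by rewrite size_cat sza /= szb -szk !addnS.
  by rewrite ffunE /= eu -sza del_slot2 del_slot0.
have := bits u p q r v erefl erefl iw; rewrite ffunE /= => -[-> ->].
have [//|nb1] := boolP (C * _ <= _); apply: contraT => nb2; exfalso.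
rewrite eu in nb1 nb2.
(* The blocks [a] and [b] leave [J.+2] positions between them for one side of the box, and
   differences of [Y] are the sizes of the boxes with this side. *)
pose a := iota 0 (size u); pose b := iota (size u + J.+2) (size v).
pose Y l := (-1) ^+ s * box b (fun w => pbox a g ((size u + l)%N :: w)).
have ib : incr (size u + J.+2) n.-1 b by apply: incr_iota; lia.
have oa : ~~ odd (size a) by rewrite size_iota.
have YE l l' : (l < l' <= J.+1)%N ->
    0 < Y l' - Y l /\ `|box (a ++ [:: (size u + l)%N, (size u + l')%N & b]) g| = Y l' - Y l.
  move=> ll'; have : 0 < (-1) ^+ s * box (a ++ [:: (size u + l)%N, (size u + l')%N & b]) g.
    apply: sgn_s; first by rewrite size_cat /= !size_iota -szk !addnS.
    rewrite incr_iota_cat //=; last by lia.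
    by rewrite (incr_weaken _ _ ib) //; lia.
  rewrite box_slot // mulrBr -/(Y l) -/(Y l') => H; split=> //.
  by rewrite -(gtr0_norm H) /Y -mulrBr normrM normrX normrN1 expr1n mul1r.
apply: (no_balanced_increments C0 CJ (Y := Y)).
  by move=> l l' /YE[]; rewrite subr_gt0.
move=> l1 l2 l3 l12 l23.
have [_ E12] := YE l1 l2 ltac:(lia); have [_ E23] := YE l2 l3 ltac:(lia).
have iab : incr 0 n (a ++ [:: (size u + l1)%N, (size u + l2)%N, (size u + l3)%N & b]).
  rewrite incr_iota_cat //=; last by lia.
  by rewrite (incr_weaken _ _ ib) //; lia.
have := bits _ _ _ _ _ (size_iota _ _) (size_iota _ _) iab.
rewrite E12 E23 ffunE /= eu (negbTE nb1) (negbTE nb2) => -[H1 H2].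
by rewrite !ltNge H1 H2.
Qed.

(** * Rapid functions *)

Definition rapid (R : realFieldType) (C : R) k n (h : seq nat -> R) : Prop :=
  exists (s : bool) (eps : seq bool),
    (forall x, size x = k -> incr 0 n x -> 0 < (-1) ^+ s * h x) /\
    forall u v y y', (size u + (size v).+1)%N = k -> (y < y')%N ->
      incr 0 n (u ++ y :: v) -> incr 0 n (u ++ y' :: v) ->
      if nth true eps (size u) then C * `|h (u ++ y :: v)| <= `|h (u ++ y' :: v)|
      else C * `|h (u ++ y' :: v)| <= `|h (u ++ y :: v)|.

Definition zero_or_rapid (R : realFieldType) (C : R) k n (h : seq nat -> R) : Prop :=
  (forall x, size x = k -> incr 0 n x -> h x = 0) \/ rapid C k n h.

Lemma zero_or_rapid_comp (R : realFieldType) (C : R) k n N e (h : seq nat -> R) :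
  embeds e n N -> zero_or_rapid C k N h -> zero_or_rapid C k n (fun x => h (map e x)).
Proof.
move=> eN [h0|[s [eps [hs hC]]]]; first by left=> x szx ix; rewrite h0 ?size_map //; exact: embeds_incr eN ix.
right; exists s, eps; split=> [x szx ix|u v y y' sz yy' iy iy'].
  by rewrite hs ?size_map //; exact: embeds_incr eN ix.
have := embeds_incr eN iy; have := embeds_incr eN iy'; rewrite !map_cat /= => iy1 iy2.
rewrite -(size_map e u); apply: hC; rewrite ?size_map //.
case: eN => elt _; apply: elt => //.
by move: iy'; rewrite incr_cat => /andP[_ /= /and3P[]].
Qed.

Lemma region_sumZ (R : realFieldType) (c : R) eps a n M x :
  region_sum eps a n (fun z => c * M z) x = c * region_sum eps a n M x.
Proof.
elim: eps a M x => [|e eps IH] a M [|y x] //=.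
by case: e; rewrite mulr_sumr; apply: eq_bigr => t _; rewrite IH.
Qed.

(** The middle of the block [3i, 3i+1, 3i+2], so that increasing tuples acquire the gaps demanded by
    [spaced]. *)
Definition triple (i : nat) : nat := (3 * i).+1.

Lemma triple_spaced a m n x : (3 * m <= n)%N -> incr a m x -> spaced (3 * a) n (map triple x).
Proof.
move=> mn; elim: x a => [//|y x IHx] a /= /and3P[ay ym /IHx ix].
rewrite /triple (_ : (3 * y).+3 = 3 * y.+1)%N; last by lia.
by rewrite -/triple ix; lia.
Qed.

(** Here [h] is the signed region sum read at spread-out points, the [b i] are the boundary terms,
    and [2 ^+ k] is the loss of [region_sum_rapid]. *)
Lemma round_one (R : realFieldType) (C : R) J k m n (g : seq nat -> R) :
  2 <= C -> C * C <= J%:R -> (3 * m + k.*2 + J + 3 <= n)%N ->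
  box_homogeneous C k n g ->
  exists (h : seq nat -> R) (b : nat -> seq nat -> R),
    (forall x, size x = k -> incr 0 m x ->
       g (map triple x) = h x + \sum_(i < k) b i (del i x)) /\
    zero_or_rapid (C / 2 ^+ k) k m h.
Proof.
move=> C2 CJ le_n hom.
have C0 : 0 < C by lra.
have sp x : incr 0 m x -> spaced 0 n.-1 (map triple x).
  by move=> ix; rewrite -(muln0 3); apply: triple_spaced ix; lia.
have [] := box_homogeneous_dichotomy C0 CJ _ hom; first by lia.
  move=> zero; have [b Hb] := region_sum_decomp (nseq k true) 0 n.-1 g.
  exists (fun=> 0), (fun i x => b i (map triple x)); split; last by left.
  move=> x szx ix; rewrite Hb ?size_nseq ?size_map ?spaced_incr ?sp //.
  set U := region_sum _ _ _ _ _; suff -> : U = 0.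
    by rewrite mulr0; congr (_ + _); apply: eq_bigr => i _; rewrite map_del.
  (* All atoms vanish, so the comparison lemma with factor 0 bounds [U] from above. *)
  apply/eqP; rewrite eq_le; apply/andP; split.
    rewrite -[leRHS](mul0r U); apply: region_sum_mono => //.
    + by move=> z; rewrite size_nseq => szz iz; rewrite zero // size_dbl szz.
    + by move=> z; rewrite size_nseq => szz iz; rewrite mul0r zero // size_dbl szz.
    + by rewrite size_nseq size_map.
    + by rewrite spaced_incr ?sp.
  apply: region_sum_ge0; rewrite ?size_nseq ?size_map ?spaced_incr ?sp //.
  by move=> z szz iz; rewrite zero // size_dbl szz.
case=> s [eps [sz_eps pos Hstep]].
have [b Hb] := region_sum_decomp eps 0 n.-1 g.
pose M z := (-1) ^+ s * box (dbl z) g.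
pose U x := region_sum eps 0 n.-1 M (map triple x).
have MU x : region_sum eps 0 n.-1 (fun z => box (dbl z) g) (map triple x) = (-1) ^+ s * U x.
  by rewrite /U region_sumZ mulrA -signr_addb addbb mul1r.
have M0' z : size z = k -> incr 0 n.-1 (dbl z) -> 0 < M z.
  by move=> szz iz; apply: pos => //; rewrite size_dbl szz.
have M0 : nneg_atoms (size eps) 0 n.-1 M.
  by move=> z szz iz; apply/ltW/M0' => //; rewrite szz.
have MC : geometric_atoms C eps 0 n.-1 M.
  move=> u v t sz i1 i2.
  have normM z : incr 0 n.-1 (dbl z) -> size z = k -> M z = `|box (dbl z) g|.
    by move=> iz szz; rewrite -[LHS]gtr0_norm ?M0' // normrM normrX normrN1 expr1n mul1r.
  rewrite !normM ?size_cat /= -?sz_eps ?sz //.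
  rewrite !dbl_cat /= -/(dbl v).
  have := Hstep (dbl u) t t.+1 t.+2 (dbl v); rewrite size_dbl doubleK; apply.
  - by rewrite odd_double.
  - by rewrite size_dbl; lia.
  move: i1 i2; have dbl_cons w z : dbl (w :: z) = [:: w, w.+1 & dbl z] by [].
  rewrite !dbl_cat !dbl_cons !incr_cat => /andP[iu /and3P[H1 H2 /and3P[H3 H4 H5]]].
  case/andP=> _ /and3P[G1 G2 /and3P[G3 G4 G5]].
  by rewrite /= (incr_weaken _ _ G5) ?(incr_weaken _ _ iu) //; lia.
have U0 x : size x = k -> incr 0 m x -> 0 < U x.
  move=> szx ix; have szx' : size (map triple x) = size eps by rewrite size_map szx.
  apply: lt_le_trans (region_sum_ge_corner M0 szx' (sp _ ix)).
  apply: M0'; last by apply: spaced_corner_incr => //; exact: sp.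
  by rewrite size_map size_zip szx' sz_eps minnn.
exists (fun x => (-1) ^+ count negb eps * ((-1) ^+ s * U x)), (fun i x => b i (map triple x)).
split.
  move=> x szx ix; rewrite Hb ?size_map ?szx ?spaced_incr ?sp // MU sz_eps.
  by congr (_ + _); apply: eq_bigr => i _; rewrite map_del.
right; exists (odd (count negb eps) (+) s), eps; split.
  move=> x szx ix; rewrite signr_addb signr_odd mulrACA -expr2 sqrr_sign mul1r.
  by rewrite mulrA -expr2 sqrr_sign mul1r U0.
have normU x : size x = k -> incr 0 m x -> `|(-1) ^+ count negb eps * ((-1) ^+ s * U x)| = U x.
  by move=> szx ix; rewrite !normrM !normrX !normrN1 !expr1n !mul1r gtr0_norm ?U0.
move=> u v y y' sz yy' iy iy'.
have szy t : size (u ++ t :: v) = k by rewrite size_cat.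
rewrite !normU //; have := sp _ iy; have := sp _ iy'; rewrite /U !map_cat /= => sy' sy.
rewrite -(size_map triple u) -sz_eps; apply: region_sum_rapid => //.
- by rewrite !size_map sz.
- by rewrite /triple; lia.
Qed.

(** * Expansions over coordinate sets *)

Definition restr (r : nat) (I : {set 'I_r}) (x : seq nat) : seq nat :=
  [seq nth 0%N x (i : 'I_r) | i <- enum I].

Lemma size_restr r (I : {set 'I_r}) x : size (restr I x) = #|I|.
Proof. by rewrite size_map -cardE. Qed.

Lemma incr_enum r (I : {set 'I_r}) : incr 0 r [seq val i | i <- enum I].
Proof.
rewrite incrE; apply/andP; split; last by apply/allP => _ /mapP[i _ ->] /=.
apply: (subseq_sorted ltn_trans (s2 := map val (enum 'I_r))).
  by apply: map_subseq; rewrite [X in subseq _ X]enumT; exact: filter_subseq.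
by rewrite val_enum_ord iota_ltn_sorted.
Qed.

Lemma incr_restr r (I : {set 'I_r}) n x : size x = r -> incr 0 n x -> incr 0 n (restr I x).
Proof.
move=> szx ix; rewrite /restr (map_comp (nth 0%N x) val).
apply: embeds_incr (incr_enum I); rewrite -szx.
move: ix; rewrite incrE => /andP[sx xn]; apply: embeds_nth => //.
Qed.

Lemma restr_map r (I : {set 'I_r}) e x : size x = r -> restr I (map e x) = map e (restr I x).
Proof.
move=> szx; rewrite /restr -map_comp; apply: eq_map => i /=.
by rewrite (nth_map 0%N) // szx.
Qed.

Lemma enum_setD1 (T : finType) (A : {set T}) x : enum (A :\ x) = rem x (enum A).
Proof.
rewrite rem_filter ?enum_uniq // /enum_mem -filter_predI.
by apply: eq_filter => y; rewrite /= !inE.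
Qed.

Lemma del_restr r (I : {set 'I_r}) x i : i \in I ->
  del (index i (enum I)) (restr I x) = restr (I :\ i) x.
Proof. by move=> iI; rewrite /restr enum_setD1 remE -map_del. Qed.

(** Boundary terms of [g_I] are thereby functions of the points in [I :\ i], and can be absorbed by
    the terms of smaller sets. *)
Lemma sum_del_restr (V : nmodType) r (I : {set 'I_r}) x (F : nat -> seq nat -> V) :
  \sum_(i < #|I|) F i (del i (restr I x)) =
  \sum_(i in I) F (index i (enum I)) (restr (I :\ i) x).
Proof.
rewrite [RHS]big_enum_val /=; apply: eq_bigr => i _.
have -> : index (enum_val i) (enum I) = i.
  by rewrite /enum_val index_uniq ?enum_uniq // -cardE.
by rewrite -del_restr ?enum_valP // /enum_val index_uniq ?enum_uniq // -cardE.
Qed.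

Lemma pbox_map (R : zmodType) b e (g : seq nat -> R) w :
  pbox b (fun x => g (map e x)) w = pbox (map e b) g (map e w).
Proof. by elim/seq_ind2step: b g => [|p|p q b IHb] g //=; rewrite -IHb. Qed.

Lemma box_type_map (R : realFieldType) (C : R) k e (g : seq nat -> R) w :
  box_type C k (fun x => g (map e x)) w = box_type C k g (map e w).
Proof.
rewrite /box_type /box !pbox_map /= map_take; congr (_, _).
by apply/ffunP => i; rewrite !ffunE !pbox_map /= !map_del.
Qed.

Lemma zero_or_rapid_weaken (R : realFieldType) (C C' : R) k n h :
  C' <= C -> zero_or_rapid C k n h -> zero_or_rapid C' k n h.
Proof.
move=> CC [h0|[s [eps [hs hC]]]]; [by left | right; exists s, eps; split=> //].
move=> u v y y' sz yy' iy iy'; have := hC u v y y' sz yy' iy iy'.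
by case: nth; apply: le_trans; rewrite ler_wpM2r.
Qed.

Definition expansion (R : nmodType) (J : finType) r
    (g : J -> {set 'I_r} -> seq nat -> R) (j : J) (x : seq nat) : R :=
  \sum_(I : {set 'I_r}) g j I (restr I x).

(** The invariant of the descent on [l]. All polynomials, indexed by [J], are treated together. *)
Definition stage (R : realFieldType) (J : finType) r (C : R) D l n
    (g : J -> {set 'I_r} -> seq nat -> R) : Prop :=
  (forall j (I : {set 'I_r}) x, (D < #|I|)%N -> g j I x = 0) /\
  (forall j (I : {set 'I_r}), (l <= #|I|)%N -> zero_or_rapid C #|I| n (g j I)).

Definition refines (R : realFieldType) (J : finType) r (C : R) D l l' N n : Prop :=
  forall g : J -> {set 'I_r} -> seq nat -> R, stage C D l N g ->
  exists e (g' : J -> {set 'I_r} -> seq nat -> R), [/\ embeds e n N,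
    forall j x, size x = r -> incr 0 n x -> expansion g j (map e x) = expansion g' j x
    & stage C D l' n g'].

Lemma refines_trans (R : realFieldType) (J : finType) r (C : R) D l1 l2 l3 N M n :
  @refines R J r C D l1 l2 N M -> @refines R J r C D l2 l3 M n ->
  @refines R J r C D l1 l3 N n.
Proof.
move=> H1 H2 g /H1[e1 [g1 [e1N E1 /H2[e2 [g2 [e2N E2 S2]]]]]].
exists (e1 \o e2), g2; split=> //; first exact: embeds_trans e1N e2N.
move=> j x szx ix; rewrite (map_comp e1 e2) E1 ?size_map ?E2 //.
exact: embeds_incr e2N ix.
Qed.

Lemma triple_embeds m n : (3 * m <= n)%N -> embeds triple m n.
Proof. by move=> mn; rewrite /triple; split; lia. Qed.

(** Boxes are compared with factor [C], rapidity is claimed only with [C / 2 ^+ r]. As [k <= r] for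
    the sets concerned, this covers the loss of the round; functions already rapid are merely
    restricted, so losses do not accumulate. *)
Lemma refines_round (R : realFieldType) (J : finType) r (C : R) D K k N n m :
  2 <= C -> C * C <= K%:R -> (k <= D)%N -> (3 * m + k.*2 + K + 3 <= n)%N ->
  (forall G : J * {set 'I_r} -> seq nat -> R, exists2 e, embeds e n N &
     forall p, box_homogeneous C k n (fun x => G p (map e x))) ->
  @refines R J r (C / 2 ^+ r) D k.+1 k N m.
Proof.
move=> C2 CK kD le_n Hhom g [g0 gZ].
have [e eN ehom] := Hhom (fun p => g p.1 p.2).
have tm : embeds triple m n by apply: triple_embeds; lia.
have [hb Hhb] := choice (fun p : J * {set 'I_r} => round_one C2 CK le_n (ehom p)).
have {Hhb}[b Hhb] := choice Hhb.
pose e' := e \o triple.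
(* Terms of [k]-sets become the functions [hb], and their boundary terms are added to the sets with
   one element less. Sets of size at least [k] receive none. *)
pose g' j (I : {set 'I_r}) x := (if #|I| == k then hb (j, I) x else g j I (map e' x)) +
  \sum_(I' : {set 'I_r} | #|I'| == k) \sum_(i in I' | I' :\ i == I)
     b (j, I') (index i (enum I')) x.
have g'E j (I : {set 'I_r}) x : (k <= #|I|)%N -> g' j I x = if #|I| == k then hb (j, I) x else g j I (map e' x).
  move=> kI; rewrite /g' [X in _ + X]big1 ?addr0 // => I' /eqP I'k.
  rewrite big1 // => i /andP[iI' /eqP EI].
  by move: kI; rewrite -EI -I'k [in X in (X <= _)%N](cardsD1 i) iI' ltnn.
exists e', g'; split; first exact: embeds_trans eN tm.
  move=> j x szx ix; rewrite /expansion big_split /=.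
  rewrite exchange_big /=.
  have -> : \sum_(I' : {set 'I_r} | #|I'| == k) \sum_(I : {set 'I_r})
      \sum_(i in I' | I' :\ i == I) b (j, I') (index i (enum I')) (restr I x)
    = \sum_(I' : {set 'I_r} | #|I'| == k) \sum_(i < k) b (j, I') i (del i (restr I' x)).
    apply: eq_bigr => I' /eqP I'k; rewrite -I'k sum_del_restr.
    rewrite (exchange_big_dep (mem I')) /=; last by move=> I i _ /andP[].
    apply: eq_bigr => i iI'; rewrite (big_pred1 (I' :\ i)) // => I.
    by rewrite iI' eq_sym.
  rewrite [X in _ + X]big_mkcond -big_split /=; apply: eq_bigr => I _.
  rewrite restr_map //; case: eqP => [Ik|_]; last by rewrite addr0.
  rewrite /e' (map_comp e triple).
  have [-> //] := Hhb (j, I); first by rewrite size_restr.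
  exact: incr_restr.
split=> [j I x DI|j I kI].
  by rewrite g'E ?ifN ?g0 //; lia.
have ZE h : zero_or_rapid (C / 2 ^+ r) #|I| m h -> (forall x, g' j I x = h x) ->
    zero_or_rapid (C / 2 ^+ r) #|I| m (g' j I).
  by move=> Zh gh; rewrite (_ : g' j I = h) //; apply/funext.
case: (eqVneq #|I| k) => [Ik|Ik].
  apply: (ZE (hb (j, I))) => [|x]; last by rewrite g'E // Ik eqxx.
  have [_] := Hhb (j, I); rewrite Ik; apply: zero_or_rapid_weaken.
  rewrite ler_pM2l ?lef_pV2 ?posrE ?exprn_gt0 //; last by lra.
  by rewrite ler_eXn2l ?ltr1n // -Ik -[leqRHS](card_ord r) max_card.
apply: (ZE (fun x => g j I (map e' x))) => [|x]; last by rewrite g'E // (negbTE Ik).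
apply: zero_or_rapid_comp (gZ j I _); first exact: embeds_trans eN tm.
by rewrite ltn_neqAle eq_sym Ik.
Qed.

(** * Dominant terms *)

(** [w] lists the points indexed by [U], possibly followed by padding. *)
Definition restr_within r (U I : {set 'I_r}) (w : seq nat) : seq nat :=
  [seq nth 0%N w (index i (enum U)) | i <- enum I].

Lemma restr_within_cat r (U I : {set 'I_r}) x p : I \subset U ->
  restr_within U I (restr U x ++ p) = restr I x.
Proof.
move=> /subsetP IU; apply/eq_in_map => i; rewrite mem_enum => /IU iU.
have lt_i : (index i (enum U) < size (enum U))%N by rewrite index_mem mem_enum.
by rewrite nth_cat size_map lt_i (nth_map i) // nth_index // mem_enum.
Qed.

Definition dominated (R : realFieldType) (J : finType) r (C : R)
    (g : J -> {set 'I_r} -> seq nat -> R) (p : J * {set 'I_r} * {set 'I_r}) (w : seq nat) : bool :=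
  let: (j, A, B) := p in
  C * `|g j A (restr_within (A :|: B) A w)| <= `|g j B (restr_within (A :|: B) B w)|.

(** A union of two sets of size at most [D] has at most [D.*2] points; the remaining entries of [w]
    are padding. *)
Definition dominance_homogeneous (R : realFieldType) (J : finType) r (C : R) D n
    (g : J -> {set 'I_r} -> seq nat -> R) : Prop :=
  forall j (I I' : {set 'I_r}), (#|I| <= D)%N -> (#|I'| <= D)%N -> I != I' ->
  forall w w', size w = D.*2 -> size w' = D.*2 -> incr 0 n w -> incr 0 n w' ->
    dominated C g (j, I, I') w = dominated C g (j, I, I') w'.

Lemma rapid_weaken (R : realFieldType) (C : R) k m n h :
  (m <= n)%N -> rapid C k n h -> rapid C k m h.
Proof.
move=> mn [s [eps [hs hC]]]; exists s, eps.
have wk x : incr 0 m x -> incr 0 n x by apply: incr_weaken.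
by split=> [x szx /wk/hs|u v y y' sz yy' /wk iy /wk iy']; [apply | apply: hC].
Qed.

(** Point [i] moves through [3i, 3i+1, 3i+2] while each other point [l] stays at [3l]. Then [h'] is
    unchanged and [h] changes by a factor of at least [C * C], more than balance at the two extreme
    positions permits. *)
Lemma rapid_not_balanced (R : realFieldType) (C : R) r (I I' : {set 'I_r}) i n (h h' : seq nat -> R) :
  0 < C -> (3 * r <= n)%N -> i \in I -> i \notin I' -> rapid C #|I| n h ->
  (forall x, size x = r -> incr 0 n x ->
     `|h' (restr I' x)| < C * `|h (restr I x)| /\ `|h (restr I x)| < C * `|h' (restr I' x)|) ->
  False.
Proof.
move=> C0 rn iI iI' [s [eps [_ hC]]] bal.
pose f t l := (if l == val i then 3 * l + t else 3 * l)%N.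
pose x t := map (f t) (iota 0 r).
have szx t : size (x t) = r by rewrite size_map size_iota.
have ix t : (t < 3)%N -> incr 0 n (x t).
  move=> t3; apply: (@embeds_incr (f t) r); last exact: incr_iota.
  by rewrite /f; split=> [l l'|l]; repeat case: eqP; lia.
have nx t l : (l < r)%N -> nth 0%N (x t) l = f t l.
  by move=> lr; rewrite (nth_map 0%N) ?size_iota // nth_iota.
have sI' t : restr I' (x t) = restr I' (x 0%N).
  apply/eq_in_map => l; rewrite mem_enum !nx // /f => lI'.
  by case: eqP => // /val_inj E; rewrite -E lI' in iI'.
have [s1 [s2 EI]] : exists s1 s2, enum I = s1 ++ i :: s2.
  have : i \in enum I by rewrite mem_enum.
  by case/splitPr=> s1 s2; exists s1, s2.
have [i1 i2] : i \notin s1 /\ i \notin s2.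
  have := enum_uniq (mem I); rewrite EI cat_uniq /= negb_or => /and3P[_ /andP[i1 _] /andP[i2 _]].
  by split.
pose u := [seq (3 * (l : 'I_r))%N | l <- s1]; pose v := [seq (3 * (l : 'I_r))%N | l <- s2].
have sI t : restr I (x t) = u ++ (3 * i + t)%N :: v.
  rewrite /restr EI map_cat /= nx // [f t i]/f eqxx; congr (_ ++ _ :: _); apply/eq_in_map => l lI.
    by rewrite nx // /f; case: eqP => // /val_inj E; rewrite -E lI in i1.
  by rewrite nx // /f; case: eqP => // /val_inj E; rewrite -E lI in i2.
have szI : (size u + (size v).+1)%N = #|I| by rewrite cardE EI size_cat !size_map.
have iI_ t : (t < 3)%N -> incr 0 n (u ++ (3 * i + t)%N :: v).
  by move=> t3; rewrite -sI; apply: incr_restr (szx t) (ix t t3).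
have H01 := hC u v (3 * i + 0)%N (3 * i + 1)%N szI ltac:(lia) (iI_ 0%N isT) (iI_ 1%N isT).
have H12 := hC u v (3 * i + 1)%N (3 * i + 2)%N szI ltac:(lia) (iI_ 1%N isT) (iI_ 2%N isT).
have [] := bal _ (szx 0%N) (ix 0%N isT); have [] := bal _ (szx 2%N) (ix 2%N isT).
rewrite !sI !(sI' 2%N); move: H01 H12.
move: `|h (u ++ (3 * i + 0)%N :: v)| `|h (u ++ (3 * i + 1)%N :: v)| `|h (u ++ (3 * i + 2)%N :: v)| => h0 h1 h2.
move: `|h' _| => k; case: nth => A B G1 G2 G3 G4.
  have : C * k < C * (C * h0) by rewrite ltr_pM2l.
  have : C * (C * h0) <= C * h1 by rewrite ler_pM2l.
  by lra.
have : C * k < C * (C * h2) by rewrite ltr_pM2l.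
have : C * (C * h2) <= C * h1 by rewrite ler_pM2l.
by lra.
Qed.

(** Of two distinct nonzero terms one dominates the other at all tuples. So the term that is largest
    at one tuple dominates everywhere, and since [C] exceeds the number of sets it decides the sign
    of the sum. *)
Lemma expansion_sign_constant (R : realFieldType) (J : finType) r (C : R) D n
    (g : J -> {set 'I_r} -> seq nat -> R) :
  #|{set 'I_r}|%:R < C -> (3 * r + D.*2 <= n)%N -> stage C D 0 n g ->
  dominance_homogeneous C D n g -> forall j, exists b : bool,
  forall x, size x = r -> incr 0 (n - D.*2) x -> (expansion g j x <= 0) = b.
Proof.
move=> rC le_n [gD gZ] hom j.
have C1 : 1 < C.
  apply: le_lt_trans rC; rewrite -[1]/(1%:R) ler_nat; apply/card_gt0P.
  by exists set0.
have C0 : 0 < C by lra.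
(* The last [D.*2] points are reserved for padding. *)
set m := (n - D.*2)%N.
have wk x : incr 0 m x -> incr 0 n x by apply: incr_weaken => //; rewrite leq_subr.
pose nz (I : {set 'I_r}) : bool := ~~ `[< forall x, size x = #|I| -> incr 0 n x -> g j I x = 0 >].
have nzP I : nz I -> rapid C #|I| n (g j I).
  by move/asboolPn; case: (gZ j I (leq0n _)).
have nzN I x : ~~ nz I -> size x = r -> incr 0 m x -> g j I (restr I x) = 0.
  move=> /negPn/asboolP H szx ix; apply: H; first by rewrite size_restr.
  by apply: incr_restr => //; apply: wk.
have nzD I : nz I -> (#|I| <= D)%N.
  by apply: contraR; rewrite -ltnNge => DI; apply/asboolP => x _ _; exact: gD.
have nz_gt0 I x : nz I -> size x = r -> incr 0 m x -> 0 < `|g j I (restr I x)|.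
  move=> /nzP[s [eps [hs _]]] szx ix; rewrite normr_gt0; apply/eqP => h0.
  have := hs _ (size_restr I x) (incr_restr I szx (wk _ ix)).
  by rewrite h0 mulr0 ltxx.
pose Q I I' := forall x, size x = r -> incr 0 m x ->
  C * `|g j I (restr I x)| <= `|g j I' (restr I' x)|.
have homQ I I' : nz I -> nz I' -> I != I' -> Q I I' \/ forall x, size x = r -> incr 0 m x ->
  `|g j I' (restr I' x)| < C * `|g j I (restr I x)|.
  move=> nI nI' II'.
  set U := I :|: I'.
  have UD : (#|U| <= D.*2)%N.
    by apply: leq_trans (leq_card_setU _ _) _; rewrite -addnn leq_add ?nzD.
  pose pad x := restr U x ++ iota m (D.*2 - #|U|).
  have sz_pad x : size (pad x) = D.*2 by rewrite size_cat size_restr size_iota; lia.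
  have i_pad x : size x = r -> incr 0 m x -> incr 0 n (pad x).
    move=> szx ix; have iU := incr_restr U szx ix.
    rewrite incr_cat (incr_weaken _ _ iU) ?leq_subr //=.
    have : incr m n (iota m (D.*2 - #|U|)) by apply: incr_iota; rewrite /m; lia.
    apply: incr_weaken => //.
    case/lastP: (restr U x) iU => [//|y z]; rewrite incrE all_rcons map_rcons last_rcons.
    by case/and3P.
  have domE x : size x = r -> incr 0 m x ->
    dominated C g (j, I, I') (pad x) = (C * `|g j I (restr I x)| <= `|g j I' (restr I' x)|).
    by move=> szx ix; rewrite /dominated /pad !restr_within_cat ?subsetUl ?subsetUr.
  pose x0 := iota 0 r.
  have sx0 : size x0 = r by rewrite size_iota.
  have ix0 : incr 0 m x0 by apply: incr_iota; rewrite /m; lia.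
  have all_eq x : size x = r -> incr 0 m x ->
      dominated C g (j, I, I') (pad x) = dominated C g (j, I, I') (pad x0).
    by move=> szx ix; apply: hom => //; rewrite ?nzD ?i_pad.
  case E : (dominated C g (j, I, I') (pad x0)); [left|right] => x szx ix.
    by rewrite -domE // all_eq.
  by rewrite ltNge -domE // all_eq // E.
(* If neither term dominated, their sizes would stay within a factor [C], although some point occurs
   in only one of the two sets. *)
have tot I I' : nz I -> nz I' -> I != I' -> Q I I' \/ Q I' I.
  move=> nI nI' II'; case: (homQ I I' nI nI' II') => [|b1]; first by left.
  rewrite eq_sym in II'; case: (homQ I' I nI' nI II') => [|b2]; first by right.
  exfalso.
  have [i iU] : exists i, i \in (I :\: I') :|: (I' :\: I).
    apply/set0Pn; apply: contra II'; rewrite setU_eq0 !setD_eq0 eqEsubset.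
    by rewrite andbC.
  have rap K : nz K -> rapid C #|K| m (g j K).
    by move/nzP; apply: rapid_weaken; rewrite leq_subr.
  have rm : (3 * r <= m)%N by rewrite /m; lia.
  move: iU; rewrite !inE => /orP[] /andP[iN iI].
    apply: (rapid_not_balanced C0 rm iI iN (rap _ nI)) => x szx ix.
    by split; [exact: b1 | exact: b2].
  apply: (rapid_not_balanced C0 rm iI iN (rap _ nI')) => x szx ix.
  by split; [exact: b2 | exact: b1].
have [noz|[I0 nI0]] : (forall I, ~~ nz I) \/ exists I, nz I.
  by case: (pickP nz) => [I nI|noz]; [right; exists I | left=> I; rewrite noz].
  exists true => x szx ix; rewrite /expansion big1 ?lexx // => I _.
  exact: nzN.
pose x0 := iota 0 r.
have sx0 : size x0 = r by rewrite size_iota.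
have ix0 : incr 0 m x0 by apply: incr_iota; rewrite /m; lia.
case: (Order.TotalTheory.arg_maxP (fun I => `|g j I (restr I x0)|) nI0) => Im nIm maxI.
have domI I x : I != Im -> size x = r -> incr 0 m x ->
    C * `|g j I (restr I x)| <= `|g j Im (restr Im x)|.
  move=> IIm szx ix; case: (boolP (nz I)) => [nI|zI]; last first.
    by rewrite nzN // normr0 mulr0.
  (* Domination in the other direction contradicts, at [x0], the choice of [Im], because [C > 1]. *)
  case: (tot I Im nI nIm IIm) => [|QI]; first by apply.
  have := QI x0 sx0 ix0; have := maxI I nI; have := nz_gt0 I x0 nI sx0 ix0.
  rewrite /= => H1 H2 H3; exfalso.
  have : 1 * `|g j Im (restr Im x0)| < C * `|g j Im (restr Im x0)|.
    by rewrite ltr_pM2r // nz_gt0.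
  by rewrite mul1r => H4; have := lt_le_trans H4 (le_trans H3 H2); rewrite ltxx.
have [s [_ [hs _]]] := nzP Im nIm.
(* The sign bit [s] is true for a negative dominant term, so it is also the truth value of
   [<= 0]. *)
exists s => x szx ix.
have G0 := nz_gt0 Im x nIm szx ix.
have : `|expansion g j x - g j Im (restr Im x)| < `|g j Im (restr Im x)|.
  rewrite /expansion (bigD1 Im) //= addrC addKr.
  apply: le_lt_trans (ler_norm_sum _ _ _) _.
  apply: (@le_lt_trans _ _ (\sum_(I : {set 'I_r}) C^-1 * `|g j Im (restr Im x)|)).
    rewrite [leRHS](bigID (fun I => I != Im)) /= -[leLHS]addr0 lerD //.
      by apply: ler_sum => I IIm; rewrite ler_pdivlMl // domI.
    by apply: sumr_ge0 => I _; rewrite mulr_ge0 // invr_ge0 ltW.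
  rewrite sumr_const -mulr_natl mulrA -[ltRHS]mul1r ltr_pM2r //.
  by rewrite ltr_pdivrMr ?mul1r.
have := hs (restr Im x); rewrite size_restr => /(_ erefl).
move=> /(_ (incr_restr _ szx (wk _ ix))).
move: (g j Im _) (expansion g j x) => a b; rewrite real_ltr_norml ?num_real //.
case: s {hs}; rewrite /= ?expr1 ?expr0 ?mulN1r ?mul1r.
  by rewrite oppr_gt0 => a0; rewrite ltr0_norm // => /andP[? ?]; apply/idP; lra.
by move=> a0; rewrite gtr0_norm // => /andP[? ?]; apply/negbTE; rewrite -ltNge; lra.
Qed.

(** * Tower heights of the homogenization steps *)

Definition boxes_homogenize (R : realFieldType) (P : finType) (C : R) k N n : Prop :=
  forall G : P -> seq nat -> R, exists2 e, embeds e n N &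
    forall p, box_homogeneous C k n (fun x => G p (map e x)).

Definition dominance_homogenizes (R : realFieldType) (J : finType) r (C : R) D N n : Prop :=
  forall g : J -> {set 'I_r} -> seq nat -> R, stage C D 0 N g ->
  exists2 e, embeds e n N &
    dominance_homogeneous C D n (fun j I x => g j I (map e x)).

Definition signs_homogenize (R : realFieldType) (J : finType) r D N n : Prop :=
  forall g : J -> {set 'I_r} -> seq nat -> R,
  (forall j (I : {set 'I_r}) x, (D < #|I|)%N -> g j I x = 0) ->
  exists2 e, embeds e n N & forall j, exists b : bool, forall x,
    size x = r -> incr 0 n x -> (expansion g j (map e x) <= 0) = b.

Lemma stage_comp (R : realFieldType) (J : finType) r (C : R) D l n N e
    (g : J -> {set 'I_r} -> seq nat -> R) :
  embeds e n N -> stage C D l N g -> stage C D l n (fun j I x => g j I (map e x)).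
Proof.
move=> eN [gD gZ]; split=> [j I x /gD|j I lI]; first exact.
exact: zero_or_rapid_comp eN (gZ j I lI).
Qed.

(** A function of no points is a constant: its sign is fixed and there is no point to move. *)
Lemma stage0 (R : realFieldType) (J : finType) r (C : R) D n
    (g : J -> {set 'I_r} -> seq nat -> R) :
  stage C D 1 n g -> stage C D 0 n g.
Proof.
move=> [gD gZ]; split=> // j I _; case: (posnP #|I|) => [->|]; last exact: gZ.
case: (ltrgtP (g j I [::]) 0) => h0.
- right; exists true, [::]; split=> [[]// _ _|u v y y']; last by rewrite addnS.
  by rewrite mulN1r oppr_gt0.
- right; exists false, [::]; split=> [[]// _ _|u v y y']; last by rewrite addnS.
  by rewrite mul1r.
- by left=> -[].
Qed.

(** The rounds for [D], [D - 1], ... cost [c] each; spreading out the points is a linear loss and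
    adds nothing. *)
Lemma refines_all (R : realFieldType) (J : finType) r (C : R) D K c :
  2 <= C -> C * C <= K%:R ->
  (forall k, (0 < k <= D)%N ->
     forced c (@boxes_homogenize R (J * {set 'I_r})%type C k)) ->
  forall d, (d < D)%N -> forced (d.+1 * c) (@refines R J r (C / 2 ^+ r) D D.+1 (D - d)).
Proof.
move=> C2 CK homC.
have round k : (0 < k <= D)%N -> forced c (@refines R J r (C / 2 ^+ r) D k.+1 k).
  move=> kD; rewrite -[c]addn0.
  apply: (forced_trans _ (homC k kD) (forced_linear (a := 3) (b := k.*2 + K + 3)
    (P := fun N n => 3 * n + (k.*2 + K + 3) <= N)%N _)) => // N M n _ HN HM.
  apply: (refines_round (K := K) (n := M)) => //; first by case/andP: kD.
  by move: HM => /=; lia.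
elim=> [|d IHd] dD; first by rewrite mul1n subn0; apply: round; rewrite dD leqnn.
rewrite mulSnr; apply: forced_trans (IHd (ltnW dD)) (round (D - d.+1)%N _); last by lia.
by move=> N M n _ H1; rewrite subnSK; [exact: refines_trans H1 | exact: ltnW].
Qed.

(** The costs [c] of a round and [c'] of the comparison of terms are parameters, since they are
    obtained in one way for [D = 1] and in another for larger [D]. *)
Lemma signs_homogenize_forced (R : realFieldType) (J : finType) r D c c' :
  (0 < D)%N ->
  (forall (C : R) K, 2 <= C -> C * C <= K%:R -> forall k, (0 < k <= D)%N ->
     forced c (@boxes_homogenize R (J * {set 'I_r})%type C k)) ->
  (forall C : R, 1 < C -> forced c' (@dominance_homogenizes R J r C D)) ->
  forced (D * c + c') (@signs_homogenize R J r D).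
Proof.
move=> D0 homB homD.
pose q := #|{set 'I_r}|.
have q0 : (0 < q)%N by apply/card_gt0P; exists set0.
(* Division by [2 ^+ r] in the rounds leaves [q.+1], more than the number of terms. *)
pose C : R := q.+1%:R * 2 ^+ r.
have D2 : (1 : R) <= 2 ^+ r by rewrite exprn_ege1 // ler1n.
have q2 : (2 : R) <= q.+1%:R by rewrite ler_nat ltnS.
have C2 : 2 <= C by apply: le_trans q2 _; rewrite ler_peMr.
have CK : C * C <= ((q.+1 * 2 ^ r) * (q.+1 * 2 ^ r))%:R by rewrite !natrM natrX.
have CE : C / 2 ^+ r = q.+1%:R by rewrite mulfK // gt_eqF // exprn_gt0.
have H1 := refines_all C2 CK (homB C _ C2 CK) (d := D.-1) ltac:(lia).
rewrite CE prednK // (_ : D - D.-1 = 1)%N in H1; last by lia.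
have H2 : forced c' (@dominance_homogenizes R J r q.+1%:R D) by apply: homD; rewrite ltr1n ltnS.
(* The additional linear loss provides the room that [expansion_sign_constant] demands. *)
have H3 : forced (c' + 0) (fun N n => exists2 M, @dominance_homogenizes R J r q.+1%:R D N M &
    (3 * n + (3 * r + D.*2) <= M)%N).
  apply: forced_trans H2 (forced_linear (a := 3) (b := 3 * r + D.*2)
    (P := fun N n => 3 * n + (3 * r + D.*2) <= N)%N _) => //.
  by move=> N M n _ HN HM; exists M.
rewrite addn0 in H3; apply: forced_trans H1 H3 => N M n _ Href [M' Hdom le_n] g gD.
have st : stage q.+1%:R D D.+1 N g.
  by split=> // j I DI; left=> x _ _; exact: gD.
have [e1 [g1 [e1N E1 /stage0 st1]]] := Href g st.
have [e2 e2N hom] := Hdom g1 st1.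
have e1n : embeds id n M' by split=> // i; lia.
exists (e1 \o e2).
  by apply: embeds_trans e1N _; exact: (embeds_trans e2N e1n).
move=> j; have rq : #|{set 'I_r}|%:R < q.+1%:R :> R by rewrite ltr_nat.
have [|b Hb] := expansion_sign_constant rq _ (stage_comp e2N st1) hom j.
  by lia.
exists b => x szx ix; rewrite (map_comp e1 e2) E1 ?size_map //; last first.
  by apply: (embeds_incr e2N); apply: incr_weaken ix => //; lia.
rewrite -(Hb x) //; last by apply: incr_weaken ix => //; lia.
by congr (_ <= 0); apply: eq_bigr => I _; rewrite restr_map.
Qed.

Lemma box_ramsey (R : realFieldType) (P : finType) (C : R) k :
  forced k.*2 (@boxes_homogenize R P C k).
Proof.
have := ramsey {ffun P -> (bool * bool) * {ffun 'I_k -> bool * bool}} k.*2.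
apply: forced_weaken => // N n _ H G.
have [e eN He] := H (fun w => [ffun p => box_type C k (G p) w]).
exists e => // p w w' szw szw' iw iw'; rewrite !box_type_map.
by have := congr1 (fun f : {ffun _} => f p) (He w w' szw szw' iw iw'); rewrite !ffunE.
Qed.

Lemma restr_within_map r (U I : {set 'I_r}) e w : I \subset U -> (#|U| <= size w)%N ->
  restr_within U I (map e w) = map e (restr_within U I w).
Proof.
move=> /subsetP IU le_U; rewrite /restr_within -map_comp; apply/eq_in_map => i.
rewrite mem_enum => /IU iU /=; rewrite (nth_map 0%N) //.
by apply: leq_trans le_U; rewrite cardE index_mem mem_enum.
Qed.

Lemma dominated_map (R : realFieldType) (J : finType) r (C : R) D
    (g : J -> {set 'I_r} -> seq nat -> R) e j (A B : {set 'I_r}) w :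
  (#|A| <= D)%N -> (#|B| <= D)%N -> size w = D.*2 ->
  dominated C (fun j I x => g j I (map e x)) (j, A, B) w = dominated C g (j, A, B) (map e w).
Proof.
move=> AD BD szw; have le_U : (#|A :|: B| <= size w)%N.
  by apply: leq_trans (leq_card_setU _ _) _; rewrite szw -addnn leq_add.
by rewrite /dominated !restr_within_map ?subsetUl ?subsetUr.
Qed.

Lemma dominance_ramsey (R : realFieldType) (J : finType) r (C : R) D :
  (0 < D)%N -> forced D.*2.-1 (@dominance_homogenizes R J r C D).
Proof.
move=> D0; have := ramsey {ffun J * {set 'I_r} * {set 'I_r} -> bool} D.*2.-1.
rewrite prednK ?double_gt0 //.
apply: forced_weaken => // N n _ H g _.
have [e eN He] := H (fun w => [ffun p => dominated C g p w]).
exists e => // j A B AD BD _ w w' szw szw' iw iw'; rewrite !(@dominated_map _ _ _ _ D) //.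
by have := congr1 (fun f : {ffun _} => f (j, A, B)) (He w w' szw szw' iw iw'); rewrite !ffunE.
Qed.

(** * Functions of one point *)

Definition weakly_monotone (R : realFieldType) N (F : nat -> R) : Prop :=
  (forall x y, (x < y)%N -> (y < N)%N -> F x <= F y) \/
  (forall x y, (x < y)%N -> (y < N)%N -> F y <= F x).

Lemma weakly_monotone_dist (R : realFieldType) N (F : nat -> R) x y z :
  weakly_monotone N F -> (x < y)%N -> (y < z)%N -> (z < N)%N ->
  `|F z - F y| <= `|F z - F x|.
Proof.
case=> mF xy yz zN; have Fxy := mF x y xy (ltn_trans yz zN); have Fyz := mF y z yz zN.
  by rewrite !ger0_norm; lra.
by rewrite !ler0_norm; lra.
Qed.

Lemma box_type1 (R : realFieldType) (C : R) (g : seq nat -> R) x y z :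
  let F t := g [:: t] in
  box_type C 1 g [:: x; y; z] = ((0 < F y - F x, F y - F x < 0),
    [ffun=> (C * `|F y - F x| <= `|F z - F y|, C * `|F z - F y| <= `|F y - F x|)]).
Proof.
rewrite /box_type /=; congr (_, _); apply/ffunP => i; rewrite !ffunE.
by case: i => [[|//]] ?.
Qed.

(** One Erdos-Rado step makes the type of a triple depend on its first two points. What remains are
    tame relations on pairs, at no further height. *)
Lemma boxes_homogenize1 (R : realFieldType) (P : finType) (C : R) :
  0 <= C -> forced 1 (@boxes_homogenize R P C 1).
Proof.
move=> C0.
pose B := (P * bool)%type.
pose tames N n := forall Q : B -> rel nat, (forall b, tame N (Q b)) ->
  exists2 e, embeds e n N & forall b, homogeneous2 n (relpre e (Q b)).
have T0 : forced 0 tames := tame_family B.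
(* The strict inequality keeps a point [M] beyond all others, to serve later as a common third
   point. *)
have T1 : forced 0 (fun N n => exists2 M, (M < N)%N & tames M n).
  have lin : forced 0 (fun N n => n < N)%N.
    by apply: (@forced_linear 1 1) => N n; rewrite mul1n addn1.
  by apply: forced_trans lin T0 => N M n _ MN HM; exists M.
have T2 : forced 0 (fun N n => exists2 M, tames N M & exists2 M', (M' < M)%N & tames M' n).
  by apply: forced_trans T0 T1 => N M n _ HN HM; exists M.
rewrite -[1%N]addn0.
apply: forced_trans (erdos_rado {ffun P -> (bool * bool) * {ffun 'I_1 -> bool * bool}} 1) T2.
move=> N M n _ HER [M2 H1 [M3 le_M H2]] G.
have [e1 [chi' [e1N E1]]] := HER (fun w => [ffun p => box_type C 1 (G p) w]).
pose F p t := G p [:: e1 t].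
(* Both strict orders of the values are transitive; homogeneity fixes the two sign bits and makes
   [F] monotone. *)
have [|e2 e2M hom2] := H1 (fun b x y => if b.2 then F b.1 x < F b.1 y else F b.1 y < F b.1 x).
  case=> p []; left=> x y z _ _ _ /=; first exact: lt_trans.
  by move=> H H'; exact: lt_trans H' H.
pose F2 p t := F p (e2 t).
have mono p : weakly_monotone M2 (F2 p).
  have [[] Hb] := hom2 (p, true).
    by left=> x y xy yM; rewrite ltW //; exact: (Hb x y xy yM).
  by right=> x y xy yM; rewrite leNgt; apply/negP => H; have := Hb x y xy yM; rewrite /= H.
have typeE p x y z : (x < y)%N -> (y < z)%N -> (z < M2)%N ->
    chi' [:: e2 x; e2 y] p = box_type C 1 (fun w => G p (map (e1 \o e2) w)) [:: x; y; z].
  move=> xy yz zM; case: e2M => e2lt e2M.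
  rewrite -(E1 [:: e2 x; e2 y] (e2 z)) //; last first.
    by rewrite /= !e2lt ?e2M //; lia.
  by rewrite ffunE box_type_map.
have typeE' p x y z : (x < y)%N -> (y < z)%N -> (z < M2)%N ->
    (chi' [:: e2 x; e2 y] p).2 ord0 =
    (C * `|F2 p y - F2 p x| <= `|F2 p z - F2 p y|, C * `|F2 p z - F2 p y| <= `|F2 p y - F2 p x|).
  by move=> xy yz zM; rewrite (typeE p x y z) // box_type1 /= ffunE.
(* With the third point at [M3], the increment from [y] to [z] is by monotonicity at most that from
   [x] to [z]. So decay is transitive, and so is the failure of growth. *)
have [|e3 e3M hom3] := H2 (fun b x y => let t := (chi' [:: e2 x; e2 y] b.1).2 ord0 in
    if b.2 then t.1 else t.2).
  case=> p [] /=; [right|left] => x y z xy yz zM3;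
    rewrite (typeE' p x y z) ?(typeE' p y z M3) ?(typeE' p x z M3) //=; try lia.
    rewrite -!ltNge => _ H; apply: lt_le_trans H _; rewrite ler_wpM2l //.
    by apply: (weakly_monotone_dist (mono p)); lia.
  move=> _ /le_trans; apply.
  by apply: (weakly_monotone_dist (mono p)); lia.
exists (e1 \o (e2 \o e3)).
  apply: embeds_trans e1N _; apply: embeds_trans e2M _.
  have idM : embeds id M3 M2 by split=> // i; lia.
  exact: (embeds_trans idM e3M).
move=> p; suff H x y z : (x < y)%N -> (y < z)%N -> (z < n)%N ->
    box_type C 1 (fun w => G p (map (e1 \o (e2 \o e3)) w)) [:: x; y; z] =
    box_type C 1 (fun w => G p (map (e1 \o (e2 \o e3)) w)) [:: 0%N; 1%N; 2%N].
  case=> [|x [|y [|z [|]]]] // [|x' [|y' [|z' [|]]]] //= _ _.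
  by rewrite !andbT => /and3P[_ xy /andP[yz zn]] /and3P[_ xy' /andP[yz' zn']]; rewrite !H //; lia.
move=> xy yz zn; have n3 : (2 < n)%N by lia.
have [b1 Hb1] := hom2 (p, true); have [b2 Hb2] := hom2 (p, false).
have [b3 Hb3] := hom3 (p, true); have [b4 Hb4] := hom3 (p, false).
case: e3M => e3lt e3M.
have main u v w : (u < v)%N -> (v < w)%N -> (w < n)%N ->
    box_type C 1 (fun w => G p (map (e1 \o (e2 \o e3)) w)) [:: u; v; w] =
    ((b1, b2), [ffun=> (b3, b4)]).
  move=> uv vw wn; have uv3 := e3lt u v uv ltac:(lia); have vw3 := e3lt v w vw wn.
  have w3 := e3M w wn.
  rewrite box_type1 subr_gt0 subr_lt0.
  rewrite -(Hb1 (e3 u) (e3 v)) -?(Hb2 (e3 u) (e3 v)) //; try lia.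
  rewrite -(Hb3 u v) -?(Hb4 u v) //; try lia.
  by rewrite /= !(typeE' p _ _ (e3 w)) //; lia.
by rewrite !main.
Qed.

Lemma zero_or_rapid1_monotone (R : realFieldType) (C : R) N h :
  1 < C -> zero_or_rapid C 1 N h -> weakly_monotone N (fun x => `|h [:: x]|).
Proof.
move=> C1 [h0|[s [eps [_ hC]]]].
  by left=> x y xy yN; rewrite !h0 //= ?yN // (ltn_trans xy yN).
have step x y : (x < y)%N -> (y < N)%N -> if nth true eps 0%N
    then `|h [:: x]| <= `|h [:: y]| else `|h [:: y]| <= `|h [:: x]|.
  move=> xy yN; have := hC [::] [::] x y erefl xy.
  rewrite /= yN (ltn_trans xy yN) => /(_ isT isT).
  by case: nth; apply: le_trans; rewrite ler_peMl // ltW.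
by move: step; case: nth => step; [left|right].
Qed.

(** For increasing [u], [u x <= u y <= v z]; for decreasing [u] the same argument applies to the
    complement. *)
Lemma tame_monotone_le (R : realFieldType) (u v : nat -> R) N :
  weakly_monotone N u -> tame N (fun x y => u x <= v y).
Proof.
case=> mu; [left|right] => x y z xy yz zN.
  by move=> _; apply: le_trans; apply: mu => //; exact: ltn_trans zN.
rewrite -!ltNge => _ H; apply: lt_le_trans H _.
by apply: mu => //; exact: ltn_trans zN.
Qed.

Lemma tame_le_monotone (R : realFieldType) (u v : nat -> R) N :
  weakly_monotone N v -> tame N (fun x y => u y <= v x).
Proof.
case=> mv; [right|left] => x y z xy yz zN.
  rewrite -!ltNge => _; apply: le_lt_trans; apply: mv => //; exact: ltn_trans zN.
by move=> _ H; apply: le_trans H _; apply: mv => //; exact: ltn_trans zN.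
Qed.

Lemma weakly_monotoneZ (R : realFieldType) (c : R) u N :
  0 <= c -> weakly_monotone N u -> weakly_monotone N (fun x => c * u x).
Proof. by move=> c0 [] mu; [left|right] => x y xy yN; rewrite ler_wpM2l // mu. Qed.

(** If the union has at most one element, the relation depends on [x] alone. Otherwise both sets are
    singletons, and a monotone function of one point is compared with a function of the other. *)
Lemma tame_dominated (R : realFieldType) (J : finType) r (C : R) N
    (g : J -> {set 'I_r} -> seq nat -> R) j (A B : {set 'I_r}) :
  1 < C -> stage C 1 0 N g -> (#|A| <= 1)%N -> (#|B| <= 1)%N -> A != B ->
  tame N (fun x y => dominated C g (j, A, B) [:: x; y]).
Proof.
move=> C1 [_ gZ] A1 B1 AB.
have C0 : 0 <= C by lra.
have [U1|U2] := leqP #|A :|: B| 1.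
  have ind (K : {set 'I_r}) x y z : K \subset A :|: B ->
      restr_within (A :|: B) K [:: x; y] = restr_within (A :|: B) K [:: x; z].
    move=> /subsetP KU; apply/eq_in_map => i; rewrite mem_enum => /KU iU.
    have : (index i (enum (A :|: B)) < 1)%N.
      by apply: leq_trans U1; rewrite cardE index_mem mem_enum.
    by case: index.
  by left=> x y z _ _ _; rewrite /= (ind A x y z) ?subsetUl // (ind B x y z) ?subsetUr.
have le_U : (#|A :|: B| <= #|A| + #|B|)%N by apply: leq_card_setU.
have /cards1P[a EA] : #|A| == 1%N by lia.
have /cards1P[b EB] : #|B| == 1%N by lia.
have aU : a \in A :|: B by rewrite EA !inE eqxx.
have bU : b \in A :|: B by rewrite EB !inE eqxx orbT.
have ab : a != b by apply: contra AB => /eqP ab; rewrite EA EB ab.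
have mono (K : {set 'I_r}) : #|K| == 1%N -> weakly_monotone N (fun x => `|g j K [:: x]|).
  by move=> /eqP K1; apply: (zero_or_rapid1_monotone C1); rewrite -K1; exact: gZ.
have U2' : #|A :|: B| = 2%N by lia.
have idx (i : 'I_r) : i \in A :|: B -> (index i (enum (A :|: B)) < 2)%N.
  by move=> iU; rewrite -U2' cardE index_mem mem_enum.
have nidx : index a (enum (A :|: B)) != index b (enum (A :|: B)).
  apply: contra ab => /eqP E.
  by rewrite -(nth_index a (s := enum (A :|: B)) (x := a)) ?mem_enum // E nth_index ?mem_enum.
have enA : enum A = [:: a] by rewrite EA enum_set1.
have enB : enum B = [:: b] by rewrite EB enum_set1.
rewrite /dominated /restr_within enA enB /=.
move: nidx (idx a aU) (idx b bU).
case: (index a _) => [|[|//]]; case: (index b _) => [|[|//]] // _ _ _ /=.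
  by apply: (tame_monotone_le (u := fun x => C * _)); apply: weakly_monotoneZ => //; apply: mono; rewrite EA cards1.
by apply: (tame_le_monotone (fun x => C * _)); apply: mono; rewrite EB cards1.
Qed.

Lemma dominance_homogenize1 (R : realFieldType) (J : finType) r (C : R) :
  1 < C -> forced 0 (@dominance_homogenizes R J r C 1).
Proof.
move=> C1; apply: forced_weaken (tame_family (J * {set 'I_r} * {set 'I_r})%type) => // N n _ H g st.
pose good (p : J * {set 'I_r} * {set 'I_r}) :=
  [&& (#|p.1.2| <= 1)%N, (#|p.2| <= 1)%N & p.1.2 != p.2].
have [|e eN He] := H (fun p x y => good p && dominated C g p [:: x; y]).
  case=> -[j A] B; rewrite /good /=; case: and3P => [[A1 B1 AB]|_]; last by left.
  exact: tame_dominated.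
exists e => // j A B A1 B1 AB.
case=> [|x [|y []]] // [|x' [|y' []]] // _ _ ixy ixy'.
have [b Hb] := He (j, A, B).
have E u v : (u < v < n)%N ->
    dominated C (fun j I x => g j I (map e x)) (j, A, B) [:: u; v] = b.
  move=> /andP[uv vn]; rewrite (@dominated_map _ _ _ _ 1) //= -(Hb u v uv vn).
  by rewrite /= /good /= A1 B1 AB.
by rewrite !E //; [move: ixy' | move: ixy] => /=; lia.
Qed.

(** * Polynomials *)

(** For [D = 1] the cost is 1 for the round and 0 for the comparison. For larger [D], [D] rounds of
    height at most [2D] and a comparison of height [2D - 1] fit. The 2 subtracted stands for the
    bottom level of [tw], which is the identity, and one exponential kept in reserve. *)
Lemma signs_homogenize_height (R : realFieldType) (J : finType) r D :
  (0 < D)%N -> forced (3 * D ^ 3 - 2) (@signs_homogenize R J r D).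
Proof.
case: D => [//|[|D]] _.
  have := @signs_homogenize_forced R J r 1 1 0 isT.
  apply=> [C K C2 _ k /andP[k0 k1]|C C1]; last exact: dominance_homogenize1.
  have -> : k = 1%N by lia.
  by apply: boxes_homogenize1; lra.
apply: (@forced_weaken (D.+2 * D.+2.*2 + D.+2.*2.-1) _ (@signs_homogenize R J r D.+2)) => //.
  by rewrite !expnS expn0; nia.
apply: signs_homogenize_forced => // [C K _ _ k /andP[_ kD]|C _]; last exact: dominance_ramsey.
by apply: forced_weaken (box_ramsey (J * {set 'I_r})%type C k) => //; rewrite leq_double.
Qed.

(** The points with a coordinate occurring in the monomial; each contributes at least 1 to the
    degree, which bounds their number. *)
Definition mnm_points r d (m : 'X_{1.. r * d}) : {set 'I_r} :=
  [set i | [exists l, m (mxvec_index i l) != 0%N]].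

Lemma big_mxvec_index (T : Type) (idx : T) (op : Monoid.com_law idx) r d (F : 'I_(r * d) -> T) :
  \big[op/idx]_(k < r * d) F k =
  \big[op/idx]_(i < r) \big[op/idx]_(l < d) F (mxvec_index i l).
Proof.
rewrite pair_big (reindex (uncurry (@mxvec_index r d))) /=; last first.
  by have [g K1 K2] := curry_mxvec_bij r d; exists g => k _; [exact: K1 | exact: K2].
by apply: eq_bigr => -[i l].
Qed.

Lemma card_mnm_points r d (m : 'X_{1.. r * d}) : (#|mnm_points m| <= mdeg m)%N.
Proof.
rewrite mdegE big_mxvec_index -sum1_card [leqRHS](bigID (mem (mnm_points m))) /=.
apply: leq_trans (leq_addr _ _); apply: leq_sum => i.
rewrite inE => /existsP[l ml]; rewrite (bigD1 l) //=.
by apply: leq_trans (leq_addr _ _); rewrite lt0n.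
Qed.

(** For [i] outside [I] the point read is a default, but its exponents are 0. *)
Definition monomials_at (R : comRingType) r d (p : {mpoly R[r * d]})
    (pts : nat -> 'I_d -> R) (I : {set 'I_r}) (w : seq nat) : R :=
  \sum_(m <- msupp p | mnm_points m == I) p@_m *
    \prod_(i < r) \prod_(l < d)
      pts (nth 0%N w (index i (enum I))) l ^+ m (mxvec_index i l).

Lemma meval_expansion (R : comRingType) r d (p : {mpoly R[r * d]})
    (pts : nat -> 'I_d -> R) x :
  p.@[fun k => mxvec (\matrix_(i < r, l < d) pts (nth 0%N x i) l) 0 k] =
  \sum_(I : {set 'I_r}) monomials_at p pts I (restr I x).
Proof.
rewrite mevalE (partition_big (@mnm_points r d) predT) //=; apply: eq_bigr => I _.
apply: eq_bigr => m /eqP mI; congr (_ * _); rewrite big_mxvec_index.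
apply: eq_bigr => i _; apply: eq_bigr => l _; rewrite mxvecE mxE.
have [iI|iI] := boolP (i \in I).
  by rewrite /restr (nth_map i) ?index_mem ?mem_enum // nth_index ?mem_enum.
move: iI; rewrite -mI inE negb_exists => /forallP/(_ l).
by rewrite negbK => /eqP->; rewrite !expr0.
Qed.

Lemma monomials_at_eq0 (R : comRingType) r d (p : {mpoly R[r * d]}) pts D
    (I : {set 'I_r}) w :
  (msize p <= D.+1)%N -> (D < #|I|)%N -> monomials_at p pts I w = 0.
Proof.
move=> pD DI; rewrite /monomials_at big_seq_cond big_pred0 // => m.
apply/negP => /andP[/msize_mdeg_lt mp /eqP mI].
by have := card_mnm_points m; rewrite mI; lia.
Qed.

Lemma expn_le_exp2 c : exists n0, forall n, (n0 <= n)%N -> (n ^ c <= 2 ^ n.-1)%N.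
Proof.
exists (c.+1 * (2 * c.+1 + 3)).+1 => n le_n.
(* It suffices that [n <= 2 ^ q], for then [n ^ c.+1 <= 2 ^ (q * c.+1) <= 2 ^ n.-1]. *)
pose q := (n.-1 %/ c.+1)%N.
have n_lt : (n.-1 < c.+1 * q.+1)%N by rewrite mulnC ltn_ceil.
have q_ge : (2 * c.+1 + 3 <= q)%N by rewrite leq_divRL // mulnC; lia.
apply: (@leq_trans ((2 ^ q) ^ c.+1)); last first.
  by rewrite -expnM leq_exp2l // leq_trunc_div.
have nq : (n <= 2 ^ q)%N.
  have [s sE] : exists s, q = (c.+1 + s.+1)%N by exists (q - c.+2)%N; lia.
  rewrite sE expnD; apply: (@leq_trans (c.+1 * q.+1)).
    by move: (c.+1 * q.+1)%N n_lt => X; lia.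
  apply: leq_mul; first exact: ltnW (ltn_expl _ _).
  move: (ltn_expl s (ltnSn 1)); rewrite expnS.
  by move: (2 ^ _)%N => z; lia.
by apply: (leq_trans (_ : _ <= n ^ c.+1)%N); [rewrite leq_pexp2l //; lia | rewrite leq_exp2r].
Qed.

Theorem theorem1p1 (R : realType) (r d D m : nat) :
  (0 < r)%N -> (0 < d)%N -> (0 < D)%N -> (0 < m)%N ->
  exists N0 : nat,
  forall (N : nat) (pts : 'I_N -> 'I_d -> R)
         (P : 'I_m -> {mpoly R[r * d]}) (Gamma : ('I_m -> bool) -> bool),
    injective pts ->
    (forall j, (msize (P j) <= D.+1)%N) ->
    (N0 <= N)%N ->
    forall n : nat,
      (0 < n)%N -> (N <= tw (3 * D ^ 3) n)%N ->
      (forall n' : nat, (0 < n')%N -> (n' < n)%N -> (tw (3 * D ^ 3) n' < N)%N) ->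
      exists S : {set 'I_N},
        #|S| = n /\ (sa_clique P Gamma pts S \/ sa_independent P Gamma pts S).
Proof.
move=> _ _ D0 _.
have [c c0 Hforced] := @signs_homogenize_height R 'I_m r D D0.
have [n0 Hn0] := expn_le_exp2 c.
set K := (3 * D ^ 3)%N in Hforced *.
have KE : K = (K - 2).+2.
  have : (0 < D ^ 3)%N by rewrite expn_gt0 D0.
  by rewrite /K; lia.
(* This bound forces [n] above both 1 and [n0]. *)
exists (tw K (maxn 1 n0)).+1 => N pts P Gamma _ PD N0N n n_gt0 leNn Hn.
have le_tw x y : (x <= y)%N -> (tw K x <= tw K y)%N by rewrite KE; exact: leq_tw.
have [n1 nn0] : (1 < n)%N /\ (n0 <= n)%N.
  have : (maxn 1 n0 < n)%N.
    by rewrite ltnNge; apply/negP => /le_tw le_n; move: (leq_trans N0N (leq_trans leNn le_n)); rewrite ltnn.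
  by rewrite gtn_max => /andP[-> /ltnW].
(* By minimality of [n], [N] exceeds [tw K n.-1], and the reserved exponential turns [n.-1] into
   [2 ^ n.-1 >= n ^ c]. *)
have twN : (tw (K - 2).+1 (n ^ c) <= N)%N.
  have /ltnW := Hn n.-1 ltac:(lia) ltac:(lia).
  apply: leq_trans; have -> : tw K n.-1 = tw (K - 2).+1 (2 ^ n.-1).
    by have := twD (K - 2) 1 n.-1; rewrite addn1 -KE => <-.
  by apply: leq_tw; exact: Hn0.
case: N pts N0N leNn Hn twN => [//|N] pts _ _ _ twN.
pose ptsn (t : nat) := pts (inord t).
have [e [e_lt e_N] He] := Hforced n N.+1 n1 twN (fun j => monomials_at (P j) ptsn)
  (fun j I w => monomials_at_eq0 ptsn w (PD j)).
have [b Hb] := choice He.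
pose v (i : 'I_n) : 'I_N.+1 := inord (e i).
have vE i : v i = e i :> nat by rewrite inordK // e_N.
have v_inj : injective v.
  move=> i i' /(congr1 (@nat_of_ord N.+1)); rewrite !vE => E; apply: ord_inj.
  case: (ltngtP i i') => // lt_ii'.
    by have := e_lt _ _ lt_ii' (ltn_ord _); rewrite E ltnn.
  by have := e_lt _ _ lt_ii' (ltn_ord _); rewrite E ltnn.
exists [set v i | i in 'I_n]; rewrite card_imset // card_ord; split=> //.
(* An increasing tuple in the image of [v] comes from an increasing tuple below [n], where every
   polynomial has its constant sign bit in [b]. *)
have edgeE t : strictly_incr t -> (forall i, t i \in [set v i | i in 'I_n]) ->
    sa_edge P Gamma pts t = Gamma b.
  move=> t_lt tS.
  have /choice[k kE] : forall i, exists a, t i = v a.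
    by move=> i; have /imsetP[a _ ->] := tS i; exists a.
  have k_lt (i i' : 'I_r) : (i < i')%N -> (k i < k i')%N.
    move=> /t_lt; rewrite !kE !vE => ekk; rewrite ltnNge leq_eqVlt negb_or -leqNgt.
    apply/andP; split; first by apply: contraL ekk => /eqP->; rewrite ltnn.
    rewrite leqNgt; apply: contraL ekk => /e_lt/(_ (ltn_ord _)); lia.
  pose x := [seq val (k i) | i <- enum 'I_r].
  have szx : size x = r by rewrite size_map size_enum_ord.
  have nx (i : 'I_r) : nth 0%N x i = k i.
    by rewrite (nth_map i) ?size_enum_ord // nth_ord_enum.
  have ix : incr 0 n x.
    (* Written as the image of [iota 0 r] under a total function on [nat], [x] is increasing by
       [embeds_incr]. *)
    have -> : x = [seq (if insub l is Some i then nat_of_ord (k i) else l) | l <- iota 0 r].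
      rewrite -val_enum_ord -map_comp; apply: eq_map => i /=.
      by rewrite valK.
    apply: (@embeds_incr _ r); last exact: incr_iota.
    split=> [l l' ll' l'r|l lr]; last by rewrite insubT.
    by rewrite !insubT ?(ltn_trans ll') // => lr; apply: k_lt.
  rewrite /sa_edge; congr (Gamma _); apply/funext => j; rewrite -(Hb j x szx ix).
  congr (_ <= 0); rewrite /expansion -meval_expansion; apply: meval_eq => a.
  congr (mxvec _ _ _); apply/matrixP => i l; rewrite !mxE.
  by rewrite (nth_map 0%N) ?szx // nx kE.
case E : (Gamma b); [left | right] => t t_lt tS; by rewrite edgeE ?E.
Qed.
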